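(* Assume $\sum_{k=0}^\infty\|B(k)\|<\infty$. Let $\bar V$ be the operator induced on $l^\infty(\mathbb X)/c_0(\mathbb X)$ by $Vx=Ax+B*x$. Suppose that $\sigma_\Gamma(\bar V)=\sigma(\bar V)\cap\Gamma$ is countable and that $$R\sigma(\bar V)\cap\Gamma=\emptyset.$$ Then: (i) If $\|A\|+\sum_{n=0}^\infty\|B(n)\|\le1$, then the equation $$x(n+1)=Ax(n)+\sum_{k=0}^nB(n-k)x(k),\qquad n\in\mathbb N_0,$$ is strongly asymptotically stable, i.e. every solution $(x(n))$ satisfies $\lim_{n\to\infty}x(n)=0$. (ii) If $y=(y(n))\in c_0(\mathbb X)$, then every bounded solution of $$x(n+1)=Ax(n)+\sum_{k=0}^nB(n-k)x(k)+y(n),\qquad n\in\mathbb N_0, \qquad (E_y)$$ is asymptotically stable, i.e. $\lim_{n\to\infty}x(n)=0$. (iii) If $y=(y(n))\in AAP(\mathbb N_0,\mathbb X)$, then every bounded solution of $(E_y)$ is asymptotically almost periodic, i.e. belongs to $AAP(\mathbb N_0,\mathbb X)$.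
   Context: $\mathbb X$ is a complex Banach space, $L(\mathbb X)$ the space of bounded linear operators on $\mathbb X$, $\mathbb N_0=\{0,1,2,\dots\}$, $\Gamma=\{z\in\mathbb C:|z|=1\}$; $A\in L(\mathbb X)$ and $B(n)\in L(\mathbb X)$ for $n\in\mathbb N_0$. $l^\infty(\mathbb X)$ is the space of bounded sequences $(x(n))_{n\ge0}$ in $\mathbb X$ with the sup-norm and $c_0(\mathbb X)$ is its closed subspace of sequences converging to $0$. $V$ is the operator on $l^\infty(\mathbb X)$ given by $(Vx)(n)=Ax(n)+(B*x)(n)$ with $(B*x)(n)=\sum_{k=0}^nB(k)x(n-k)$. Under $\sum\|B(k)\|<\infty$, $V$ is bounded and leaves $c_0(\mathbb X)$ invariant, hence induces a bounded operator $\bar V$ on the quotient $l^\infty(\mathbb X)/c_0(\mathbb X)$. For a bounded operator $T$ on a Banach space, $\sigma(T)$ is its spectrum, $\sigma_\Gamma(T)=\sigma(T)\cap\Gamma$, and its residual spectrum $R\sigma(T)$ is here defined as the set of all $\lambda\in\mathbb C$ such that the range of $\lambda-T$ is not dense. $AP(\mathbb Z,\mathbb X)$ is the closure, in the space of bounded sequences on $\mathbb Z$ with the sup-norm, of the linear span of the sequences $(\lambda^ny_0)_{n\in\mathbb Z}$ with $\lambda\in\Gamma$, $y_0\in\mathbb X$. $AP(\mathbb N_0,\mathbb X)$ is the set of restrictions to $\mathbb N_0$ of elements of $AP(\mathbb Z,\mathbb X)$. $AAP(\mathbb N_0,\mathbb X)$ is the set of asymptotically almost periodic sequences, i.e. those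 $x\in l^\infty(\mathbb X)$ of the form $x=u+w$ with $u\in c_0(\mathbb X)$ and $w\in AP(\mathbb N_0,\mathbb X)$. *)

(* Defs.v *)
From HB Require Import structures.
From mathcomp Require Import all_boot all_order all_algebra.
From mathcomp Require Import complex zify.
From mathcomp Require Import all_classical all_reals all_analysis.

Set Implicit Arguments.
Unset Strict Implicit.
Unset Printing Implicit Defensive.

Import Order.TTheory GRing.Theory Num.Theory.
Import numFieldNormedType.Exports.

Local Open Scope classical_set_scope.
Local Open Scope complex_scope.
Local Open Scope ring_scope.

(* The norm of a normed module over R[i] takes its values in R[i];
   [rnorm] is the same norm as a real number. *)
Definition rnorm (R : realType) (E : normedModType R[i]) (x : E) : R :=
  complex.Re `|x|.
Arguments rnorm : simpl never.

Definition cabs (R : realType) (z : R[i]) : R := complex.Re `|z|.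
Arguments cabs : simpl never.

Lemma ReK_ge0 (R : realType) (z : R[i]) : 0 <= z -> (complex.Re z)%:C = z.
Proof. by move=> z0; apply: RRe_real; rewrite ger0_real. Qed.

Lemma cabsE (R : realType) (z : R[i]) : `|z| = (cabs z)%:C.
Proof. by rewrite /cabs ReK_ge0. Qed.

Lemma cabs_ge0 (R : realType) (z : R[i]) : 0 <= cabs z.
Proof. by rewrite -lecR -cabsE normr_ge0. Qed.

Lemma cabs0 (R : realType) : cabs (0 : R[i]) = 0.
Proof. by rewrite /cabs normr0. Qed.

Section RealNorm.
Context {R : realType} {E : normedModType R[i]}.
Implicit Types x y : E.

Lemma rnormE x : `|x| = (rnorm x)%:C.
Proof. by rewrite /rnorm ReK_ge0. Qed.

Lemma rnorm_ge0 x : 0 <= rnorm x.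
Proof. by rewrite -lecR -rnormE normr_ge0. Qed.

Lemma rnormD x y : rnorm (x + y) <= rnorm x + rnorm y.
Proof. by rewrite -lecR rmorphD/= -!rnormE ler_normD. Qed.

Lemma rnorm0 : rnorm (0 : E) = 0.
Proof. by rewrite /rnorm normr0. Qed.

Lemma rnorm0_eq0 x : rnorm x = 0 -> x = 0.
Proof. by move=> x0; apply: normr0_eq0; rewrite rnormE x0. Qed.

Lemma rnormN x : rnorm (- x) = rnorm x.
Proof. by rewrite /rnorm normrN. Qed.

Lemma rnormZ (l : R[i]) x : rnorm (l *: x) = cabs l * rnorm x.
Proof.
by apply: complexI; rewrite rmorphM/= -!rnormE normrZ cabsE.
Qed.

End RealNorm.

Section BoundedFunctions.
Context {R : realType} {I : Type} {X : normedModType R[i]}.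

Definition bounded_pred : {pred I -> X} :=
  fun x => `[< bounded_fun x >].

Lemma bounded_predP (x : I -> X) :
  reflect (exists M : R, forall i, rnorm (x i) <= M) (x \in bounded_pred).
Proof.
apply: (iffP (asboolP _)) => [|[M xM]].
  move=> /pinfty_ex_gt0[M M0 Mx]; exists (complex.Re M) => i.
  by rewrite -lecR -rnormE ReK_ge0 ?(ltW M0)//; exact: (Mx i).
exists M%:C; split=> [|N MN i _ /=]; first by apply/complex_realP; exists M.
by rewrite (le_trans _ (ltW MN))// rnormE lecR.
Qed.

Lemma bounded_pred_submod : submod_closed bounded_pred.
Proof.
split=> [|l x y /bounded_predP[M xM] /bounded_predP[N yN]].
  by apply/bounded_predP; exists 0 => i; rewrite rnorm0.
apply/bounded_predP; exists (cabs l * M + N) => i.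
apply: (le_trans (rnormD _ _)); apply: lerD; last exact: yN.
by rewrite rnormZ ler_wpM2l// cabs_ge0.
Qed.

HB.instance Definition _ :=
  GRing.isSubmodClosed.Build R[i] (I -> X) bounded_pred bounded_pred_submod.

End BoundedFunctions.

Record linf (R : realType) (I : Type) (X : normedModType R[i]) := Linf {
  linf_fun :> I -> X;
  linf_bounded : linf_fun \in bounded_pred }.

Section Linf.
Context {R : realType} {I : Type} {X : normedModType R[i]}.
Local Notation linf := (linf I X).

HB.instance Definition _ := [isSub for @linf_fun R I X].
HB.instance Definition _ := [Choice of linf by <:].
HB.instance Definition _ := [SubChoice_isSubLmodule of linf by <:].

Implicit Types x y : linf.

Lemma linfP x y : (forall i, x i = y i) -> x = y.
Proof. by move=> xy; apply/val_inj/funext. Qed.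

Definition supnorm (x : linf) : R := sup (range (fun i => rnorm (x i))).

Lemma rnorm_le_supnorm x i : rnorm (x i) <= supnorm x.
Proof.
apply: ub_le_sup; last by exists i.
by have /bounded_predP[M xM] := linf_bounded x; exists M => _ [j _ <-].
Qed.

Lemma supnorm_le x (M : R) :
  0 <= M -> (forall i, rnorm (x i) <= M) -> supnorm x <= M.
Proof.
move=> M0 xM; have [[i _]|noI] := pselect (exists i : I, True).
  by apply: ge_sup => [|_ [j _ <-]//]; exists (rnorm (x i)), i.
have r0 : range (fun i => rnorm (x i)) = set0.
  by rewrite -subset0 => r [i _ _]; apply: noI; exists i.
by rewrite /supnorm r0 sup0.
Qed.

Lemma supnorm_ge0 x : 0 <= supnorm x.
Proof.
have [[i _]|noI] := pselect (exists i : I, True).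
  exact: le_trans (rnorm_ge0 (x i)) (rnorm_le_supnorm x i).
have r0 : range (fun i => rnorm (x i)) = set0.
  by rewrite -subset0 => r [i _ _]; apply: noI; exists i.
by rewrite /supnorm r0 sup0.
Qed.

Let lnorm x : R[i] := (supnorm x)%:C.

Let lnormD x y : lnorm (x + y) <= lnorm x + lnorm y.
Proof.
rewrite /lnorm -rmorphD lecR; apply: supnorm_le => [|i].
  by rewrite addr_ge0// supnorm_ge0.
by rewrite (le_trans (rnormD _ _))// lerD// rnorm_le_supnorm.
Qed.

Let lnormZ (l : R[i]) x : lnorm (l *: x) = `|l| * lnorm x.
Proof.
have le (k : R[i]) z : supnorm (k *: z) <= cabs k * supnorm z.
  apply: supnorm_le => [|i]; first by rewrite mulr_ge0// ?cabs_ge0 ?supnorm_ge0.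
  rewrite [X in rnorm X](_ : _ = k *: z i)// rnormZ.
  by rewrite ler_wpM2l// ?cabs_ge0 ?rnorm_le_supnorm.
rewrite /lnorm cabsE -rmorphM; congr (_%:C).
apply/eqP; rewrite eq_le le/=.
have [->|l0] := eqVneq l 0; first by rewrite cabs0 mul0r supnorm_ge0.
have Rl : 0 < cabs l by rewrite -ltcR -cabsE normr_gt0.
rewrite -ler_pdivlMl//; have := le l^-1 (l *: x).
rewrite scalerA mulVf// scale1r => /le_trans; apply.
rewrite ler_wpM2r ?supnorm_ge0// le_eqVlt; apply/orP; left.
by apply/eqP/complexI; rewrite -cabsE normfV cabsE fmorphV.
Qed.

Let lnorm0_eq0 x : lnorm x = 0 -> x = 0.
Proof.
move=> /complexI x0; apply: linfP => i; apply: rnorm0_eq0.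
by apply/eqP; rewrite eq_le rnorm_ge0 andbT -x0 rnorm_le_supnorm.
Qed.

HB.instance Definition _ :=
  Lmodule_isNormed.Build R[i] linf lnormD lnormZ lnorm0_eq0.

Lemma rnorm_linfE x : rnorm x = supnorm x.
Proof. by []. Qed.

End Linf.

Section NullSequences.
Context {R : realType} {X : normedModType R[i]}.
Local Notation linf := (linf nat X).

Definition c0_pred : {pred linf} :=
  fun x => `[< x n @[n --> \oo] --> (0 : X) >].

Lemma c0_predP (x : linf) :
  reflect (x n @[n --> \oo] --> (0 : X)) (x \in c0_pred).
Proof. exact: asboolP. Qed.

Lemma c0_pred_submod : submod_closed c0_pred.
Proof.
split=> [|l x y /c0_predP x0 /c0_predP y0]; apply/c0_predP.
  by change ((fun _ : nat => 0 : X) @ \oo --> (0 : X)); exact: cvg_cst.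
rewrite -[X in _ --> X]addr0 -[X in _ --> X + _](scaler0 _ l).
change ((l *: x n + y n) @[n --> \oo] --> l *: (0 : X) + 0).
by apply: cvgD => //; apply: cvgZr.
Qed.

HB.instance Definition _ :=
  GRing.isSubmodClosed.Build R[i] linf c0_pred c0_pred_submod.

End NullSequences.

Definition linf_mod_c0 (R : realType) (X : normedModType R[i]) : Type :=
  Quotient.quot (@c0_pred R X).

Section QuotientSpace.
Context {R : realType} {X : normedModType R[i]}.
Local Notation linf := (linf nat X).
Local Notation quo := (linf_mod_c0 X).

HB.instance Definition _ := GRing.Zmodule.on quo.

Definition cls (x : linf) : quo := (\pi_(Quotient.quot (@c0_pred R X)) x)%qT.
Definition rep (q : quo) : linf := repr (q : Quotient.quot (@c0_pred R X)).

Lemma repK q : cls (rep q) = q.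
Proof. exact: reprK. Qed.

Lemma clsP x y : reflect (cls x = cls y) (x - y \in c0_pred).
Proof. by rewrite Quotient.idealrBE; apply: eqP. Qed.

Lemma clsD x y : cls (x + y) = cls x + cls y.
Proof. exact: (Quotient.pi_add (@c0_pred R X)). Qed.

Lemma cls0 : cls 0 = 0.
Proof. by apply: (addrI (cls 0)); rewrite -clsD !addr0. Qed.

Let qscale (l : R[i]) (q : quo) : quo := cls (l *: rep q).

Let qscale_cls l x : qscale l (cls x) = cls (l *: x).
Proof. by apply/clsP; rewrite -scalerBr rpredZ//; apply/clsP; rewrite repK. Qed.

Let qscaleA l m q : qscale l (qscale m q) = qscale (l * m) q.
Proof. by rewrite -[q]repK !qscale_cls scalerA. Qed.

Let qscale1 : left_id 1 qscale.
Proof. by move=> q; rewrite -[q]repK qscale_cls scale1r. Qed.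

Let qscaleDr : right_distributive qscale +%R.
Proof.
by move=> l p q; rewrite -[p]repK -[q]repK -clsD !qscale_cls -clsD scalerDr.
Qed.

Let qscaleDl q : {morph qscale^~ q : l m / l + m}.
Proof. by move=> l m; rewrite -[q]repK !qscale_cls -clsD scalerDl. Qed.

HB.instance Definition _ := GRing.Zmodule_isLmodule.Build R[i] quo
  qscaleA qscale1 qscaleDr qscaleDl.

Lemma clsZ l x : cls (l *: x) = l *: cls x.
Proof. by rewrite -qscale_cls. Qed.

Definition quonorm (q : quo) : R :=
  inf [set supnorm x | x in [set x : linf | cls x = q]].

Lemma quonorm_le x : quonorm (cls x) <= supnorm x.
Proof.
apply: ge_inf; last by exists x.
by exists 0 => _ [y _ <-]; exact: supnorm_ge0.
Qed.

Lemma quonorm_ge (q : quo) (M : R) :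
  (forall x, cls x = q -> M <= supnorm x) -> M <= quonorm q.
Proof.
move=> qM; apply: lb_le_inf; last by move=> _ [x xq <-]; exact: qM.
by exists (supnorm (rep q)), (rep q) => //=; exact: repK.
Qed.

Lemma quonorm_ge0 q : 0 <= quonorm q.
Proof. by apply: quonorm_ge => x _; exact: supnorm_ge0. Qed.

Let qnorm (q : quo) : R[i] := (quonorm q)%:C.

Let qnormD p q : qnorm (p + q) <= qnorm p + qnorm q.
Proof.
rewrite /qnorm -rmorphD lecR -lerBlDr; apply: quonorm_ge => x xp.
rewrite lerBlDr -lerBlDl; apply: quonorm_ge => y yq.
rewrite lerBlDl -xp -yq -clsD (le_trans (quonorm_le _))//.
have := ler_normD x y.
by rewrite !rnormE -rmorphD lecR.
Qed.

Let qnormZ (l : R[i]) q : qnorm (l *: q) = `|l| * qnorm q.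
Proof.
have supZ (k : R[i]) (x : linf) : supnorm (k *: x) = cabs k * supnorm x.
  by rewrite -!rnorm_linfE rnormZ.
have le (k : R[i]) p : cabs k * quonorm p <= quonorm (k *: p).
  have [->|k0] := eqVneq k 0; first by rewrite cabs0 mul0r quonorm_ge0.
  have kk : 0 < cabs k by rewrite -ltcR -cabsE normr_gt0.
  apply: quonorm_ge => x xp; rewrite -ler_pdivlMl//.
  have <- : cls (k^-1 *: x) = p by rewrite clsZ xp scalerA mulVf// scale1r.
  apply: (le_trans (quonorm_le _)); rewrite supZ.
  suff -> : cabs k^-1 = (cabs k)^-1 by [].
  by apply: complexI; rewrite -cabsE normfV cabsE fmorphV.
rewrite /qnorm cabsE -rmorphM; congr (_%:C); apply/eqP; rewrite eq_le le andbT.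
have [->|l0] := eqVneq l 0.
  rewrite scale0r -cls0 cabs0 mul0r (le_trans (quonorm_le _))//.
  by rewrite supnorm_le// => i; rewrite rnorm0.
have ll : 0 < cabs l by rewrite -ltcR -cabsE normr_gt0.
rewrite -ler_pdivrMl//; apply: quonorm_ge => x <-.
by rewrite ler_pdivrMl// -supZ -clsZ quonorm_le.
Qed.

Let qnorm0_eq0 q : qnorm q = 0 -> q = 0.
Proof.
move=> /complexI q0; rewrite -[q]repK -cls0; apply/clsP; rewrite subr0.
apply/c0_predP/cvgrPdist_lt => e e0.
have er0 : 0 < complex.Re e by rewrite -ltcR ReK_ge0// ltW.
have [_ [y yq <-] ye] : exists2 r,
    [set supnorm x | x in [set x : linf | cls x = q]] r & r < complex.Re e / 2.
  apply: inf_lt; last by rewrite -/(quonorm q) q0 divr_gt0.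
  by exists (supnorm (rep q)), (rep q) => //=; exact: repK.
have /c0_predP : rep q - y \in c0_pred by apply/clsP; rewrite repK.
move=> /cvgrPdist_lt/(_ (complex.Re e / 2)%:C).
rewrite ltcR divr_gt0// => /(_ isT).
apply: filterS => n; rewrite !sub0r !normrN => h.
have -> : rep q n = (rep q - y) n + y n by rewrite /= addrNK.
apply: (le_lt_trans (ler_normD _ _)).
rewrite -[e]ReK_ge0 ?ltW// [complex.Re e]splitr rmorphD.
apply: ltrD => //.
by rewrite rnormE ltcR (le_lt_trans (rnorm_le_supnorm _ _)).
Qed.

HB.instance Definition _ :=
  Lmodule_isNormed.Build R[i] quo qnormD qnormZ qnorm0_eq0.

Lemma rnorm_quoE q : rnorm q = quonorm q.
Proof. by []. Qed.

End QuotientSpace.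

Section Operators.
Context {R : realType} {E : normedModType R[i]}.

Definition opnorm (T : E -> E) : R :=
  sup [set rnorm (T x) | x in [set x | rnorm x <= 1]].

Lemma opnorm_ub (T : {linear E -> E}) : continuous T ->
  has_ubound [set rnorm (T x) | x in [set x | rnorm x <= 1]].
Proof.
move=> /linear_bounded_continuous/linear_boundedP/pinfty_ex_gt0[M M0 TM].
exists (complex.Re M) => _ [x /= x1 <-].
rewrite -lecR -rnormE ReK_ge0 ?(ltW M0)// (le_trans (TM x))//.
by rewrite ger_pMr// rnormE lecR.
Qed.

Lemma opnorm_ge0 (T : {linear E -> E}) : continuous T -> 0 <= opnorm T.
Proof.
move=> /opnorm_ub Tub; apply: ub_le_sup => //; exists 0; rewrite /= ?rnorm0//.
by rewrite linear0 rnorm0.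
Qed.

Lemma le_opnorm (T : {linear E -> E}) (x : E) : continuous T ->
  rnorm (T x) <= opnorm T * rnorm x.
Proof.
move=> Tc; have [x0|x0] := eqVneq (rnorm x) 0.
  by rewrite (rnorm0_eq0 x0) linear0 rnorm0 mulr0.
have xp : 0 < rnorm x by rewrite lt_neqAle eq_sym x0 rnorm_ge0.
have cV : cabs (rnorm x)^-1%:C = (rnorm x)^-1.
  by apply: complexI; rewrite -cabsE ger0_norm// lecR invr_ge0 ltW.
rewrite -ler_pdivrMr// mulrC -cV -rnormZ -linearZ.
apply: ub_le_sup; first exact: opnorm_ub.
by exists ((rnorm x)^-1%:C *: x) => //=; rewrite rnormZ cV mulVf.
Qed.

Definition spectrum (T : E -> E) : set R[i] :=
  [set l | ~ exists S : {linear E -> E},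
     [/\ continuous S, cancel (fun x => l *: x - T x) S
       & cancel S (fun x => l *: x - T x)]].

Definition residual_spectrum (T : E -> E) : set R[i] :=
  [set l | ~ dense (range (fun x => l *: x - T x))].

Definition linear_span (D : set E) : set E :=
  [set v | exists m (c : 'I_m -> R[i]) (e : 'I_m -> E),
     (forall j, D (e j)) /\ v = \sum_j c j *: e j].

End Operators.

Definition unit_circle (R : realType) : set R[i] := [set z | `|z| = 1].
Arguments unit_circle R : clear implicits.

Section Volterra.
Context {R : realType} {X : normedModType R[i]}.

Implicit Types (A : {linear X -> X}) (B : nat -> {linear X -> X}).

Definition conv B (x : nat -> X) (n : nat) : X :=
  \sum_(k < n.+1) B k (x (n - k)%N).

(* [insubd 0 f] is [f] when [f] is bounded, see [VopE]. *)
Definition Vop A B (x : linf nat X) : linf nat X :=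
  insubd (0 : linf nat X) (fun n => A (x n) + conv B x n).

(* Independent of the choice of representatives, see [Vbar_cls]. *)
Definition Vbar A B (q : linf_mod_c0 X) : linf_mod_c0 X := cls (Vop A B (rep q)).

Section Induced.
Variables (A : {linear X -> X}) (B : nat -> {linear X -> X}).
Hypotheses (cA : continuous A) (cB : forall k, continuous (B k)).
Hypothesis sB : (\sum_(0 <= k <oo) (opnorm (B k))%:E < +oo)%E.

Let b k := opnorm (B k).
Let S : R := fine (\sum_(0 <= k <oo) (b k)%:E).

Let b0 k : 0 <= b k. Proof. exact: opnorm_ge0. Qed.

Let SE : (S%:E = \sum_(0 <= k <oo) (b k)%:E)%E.
Proof.
by rewrite /S fineK// ge0_fin_numE// nneseries_ge0// => k _ _; rewrite lee_fin.
Qed.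

Let series_le n : \sum_(0 <= k < n) b k <= S.
Proof.
rewrite -lee_fin -sumEFin SE; apply: nneseries_lim_ge => k _ _.
by rewrite lee_fin.
Qed.

Let S0 : 0 <= S.
Proof. by apply: le_trans (series_le 0); rewrite big_nil. Qed.

Let series_cvg : (\sum_(0 <= k < n) b k) @[n --> \oo] --> S.
Proof.
have : (\sum_(0 <= k < n) (b k)%:E)%E @[n --> \oo] --> S%:E.
  by rewrite SE; apply: is_cvg_nneseries => k _ _; rewrite lee_fin.
move=> /fine_cvg; apply: cvg_trans; apply: near_eq_cvg; near=> n.
by rewrite /= sumEFin.
Unshelve. all: by end_near. Qed.

Let conv_le (x : linf nat X) n :
  rnorm (conv B x n) <=
  \sum_(0 <= k < n.+1) b k * rnorm (x (n - k)%N).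
Proof.
rewrite /conv big_mkord; elim/big_ind2 : _ => [|u p v q up vq|k _].
- by rewrite rnorm0.
- by rewrite (le_trans (rnormD _ _))// lerD.
- exact: le_opnorm.
Qed.

Let V_bounded (x : linf nat X) :
  (fun n => A (x n) + conv B x n) \in bounded_pred.
Proof.
apply/bounded_predP; exists (opnorm A * supnorm x + S * supnorm x) => n.
apply: (le_trans (rnormD _ _)); apply: lerD.
  apply: (le_trans (le_opnorm _ cA)).
  by rewrite ler_wpM2l ?opnorm_ge0// rnorm_le_supnorm.
apply: (le_trans (conv_le _ _)).
apply: (@le_trans _ _ (\sum_(0 <= k < n.+1) b k * supnorm x)).
  by apply: ler_sum => k _; rewrite ler_wpM2l// rnorm_le_supnorm.
by rewrite -mulr_suml ler_wpM2r ?supnorm_ge0.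
Qed.

Lemma VopE (x : linf nat X) n : Vop A B x n =
  A (x n) + conv B x n.
Proof.
rewrite /Vop -[LHS]/(val _ n) val_insubd.
by rewrite V_bounded.
Qed.

Lemma Vop_le (x : linf nat X) :
  supnorm (Vop A B x) <= (opnorm A + S) * supnorm x.
Proof.
apply: supnorm_le => [|n].
  by rewrite mulr_ge0 ?supnorm_ge0// addr_ge0// opnorm_ge0.
rewrite VopE (le_trans (rnormD _ _))// mulrDl; apply: lerD.
  apply: (le_trans (le_opnorm _ cA)).
  by rewrite ler_wpM2l ?opnorm_ge0// rnorm_le_supnorm.
apply: (le_trans (conv_le _ _)).
apply: (@le_trans _ _ (\sum_(0 <= k < n.+1) b k * supnorm x)).
  by apply: ler_sum => k _; rewrite ler_wpM2l// rnorm_le_supnorm.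
by rewrite -mulr_suml ler_wpM2r ?supnorm_ge0.
Qed.

Lemma Vop_linear : linear (Vop A B).
Proof.
move=> l x y; apply: linfP => n.
rewrite [RHS](_ : _ = l *: Vop A B x n + Vop A B y n)//.
rewrite !VopE/= linearP scalerDr addrACA; congr (_ + _).
by rewrite /conv scaler_sumr -big_split; apply: eq_bigr => k _; rewrite linearP.
Qed.

Lemma Vop_c0 (x : linf nat X) : x \in c0_pred ->
  Vop A B x \in c0_pred.
Proof.
move=> /c0_predP x0; apply/c0_predP.
rewrite (_ : (fun n => Vop A B x n) =
    (fun n => A (x n)) + (fun n => conv B x n)); last first.
  by apply/funext => n; rewrite VopE.
rewrite -(addr0 (0 : X)); apply: cvgD.
  by have := cvg_comp _ _ x0 (cA (x := 0)); rewrite linear0.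
apply/cvgrPdist_lt => e e0; set d := complex.Re e.
have d0 : 0 < d by rewrite -ltcR ReK_ge0// ltW.
have ed : e = d%:C by rewrite ReK_ge0// ltW.
pose M := supnorm x; have M0 : 0 <= M by exact: supnorm_ge0.
pose d1 := d / 2 / (S + 1); have d10 : 0 < d1.
  by rewrite divr_gt0// ?divr_gt0// ltr_wpDl.
pose d2 := d / 2 / (M + 1); have d20 : 0 < d2.
  by rewrite divr_gt0// ?divr_gt0// ltr_wpDl.
have [N _ xN] : \forall n \near \oo, rnorm (x n) < d1.
  move/cvgrPdist_lt : x0 => /(_ d1%:C); rewrite ltcR d10 => /(_ isT).
  by apply: filterS => n; rewrite sub0r normrN rnormE ltcR.
have [K _ sK] : \forall n \near \oo, S - \sum_(0 <= k < n) b k < d2.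
  move/cvgrPdist_lt : series_cvg => /(_ d2 d20).
  by apply: filterS => n; apply: le_lt_trans; exact: ler_norm.
near=> n.
rewrite sub0r normrN rnormE ed ltcR (le_lt_trans (conv_le _ _))//.
have NKn : (N + K <= n)%N by near: n; exists (N + K)%N.
pose m := (n.+1 - N)%N.
rewrite (@big_cat_nat _ _ _ m)//= ?leq_subr// [d]splitr.
apply: ler_ltD.
  apply: (@le_trans _ _ (\sum_(0 <= k < m) b k * d1)).
    rewrite big_nat [leRHS]big_nat; apply: ler_sum => k /andP[_ km].
    by rewrite ler_wpM2l// ltW//; apply: xN => /=; rewrite /m in km; lia.
  rewrite -mulr_suml (le_trans (ler_wpM2r (ltW d10) (series_le m)))//.
  rewrite /d1 mulrCA ler_piMr ?divr_ge0 ?ltW//.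
  by rewrite ltr_pdivrMr ?ltr_wpDl// mul1r ltrDl.
apply: (@le_lt_trans _ _ (\sum_(m <= k < n.+1) b k * M)).
  by apply: ler_sum => k _; rewrite ler_wpM2l// rnorm_le_supnorm.
rewrite -mulr_suml.
have : \sum_(m <= k < n.+1) b k <= S - \sum_(0 <= k < m) b k.
  by rewrite lerBrDl -big_cat_nat//= ?leq_subr.
move/(ler_wpM2r M0)/le_lt_trans; apply.
apply: (@le_lt_trans _ _ (d2 * M)).
  by rewrite ler_wpM2r// ltW//; apply: sK => /=; rewrite /m; lia.
rewrite /d2 -[ltLHS]mulrA gtr_pMr ?divr_gt0//.
by rewrite ltr_pdivrMl ?ltr_wpDl// mulr1 ltrDl.
Unshelve. all: by end_near. Qed.

Lemma Vbar_cls (x : linf nat X) :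
  Vbar A B (cls x) = cls (Vop A B x).
Proof.
apply/clsP; set Y := Vop _ _ x.
have /Vop_c0 : rep (cls x) - x \in c0_pred by apply/clsP; rewrite repK.
rewrite (_ : rep _ - x = -1 *: x + rep (cls x)); last first.
  by rewrite scaleN1r addrC.
by rewrite Vop_linear scaleN1r addrC.
Qed.

Lemma Vbar_linear : linear (Vbar A B).
Proof.
move=> l p q; rewrite -[p]repK -[q]repK -clsZ -clsD !Vbar_cls Vop_linear.
by rewrite clsD clsZ.
Qed.

Lemma Vbar_le (q : linf_mod_c0 X) :
  rnorm (Vbar A B q) <= (opnorm A + S) * rnorm q.
Proof.
have S1 : 0 <= opnorm A + S by rewrite addr_ge0// opnorm_ge0.
move: S1; rewrite le_eqVlt => /orP[/eqP S1|S1].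
  rewrite -S1 mul0r -[q]repK Vbar_cls rnorm_quoE (le_trans (quonorm_le _))//.
  by rewrite (le_trans (Vop_le _))// -S1 mul0r.
rewrite -ler_pdivrMl// [leRHS]rnorm_quoE; apply: quonorm_ge => x <-.
rewrite ler_pdivrMl// Vbar_cls rnorm_quoE (le_trans (quonorm_le _))//.
exact: Vop_le.
Qed.

End Induced.
End Volterra.

Section AlmostPeriodic.
Context {R : realType} {X : normedModType R[i]}.

Definition ap_exponentials : set (linf int X) :=
  [set e | exists (l : R[i]) (y0 : X), `|l| = 1 /\ forall n, e n = l ^ n *: y0].

Definition AP_int : set (linf int X) := closure (linear_span ap_exponentials).

Definition AP_nat : set (linf nat X) :=
  [set w | exists2 v : linf int X, AP_int v & forall n : nat, w n = v n%:Z].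

Definition AAP_nat : set (linf nat X) :=
  [set x | exists u w : linf nat X,
     [/\ u \in c0_pred, AP_nat w & x = u + w]].

End AlmostPeriodic.

(* Main.v *)
From HB Require Import structures.
Require Import Defs.
From mathcomp Require Import all_boot all_order all_algebra.
From mathcomp Require Import complex.
From mathcomp Require Import all_classical all_reals all_analysis.
From mathcomp Require Import zify ring lra.

(** Write [S] for the left shift and [V] for the Volterra operator, both induced
    on the quotient of the bounded sequences by the null sequences. There [S] is
    an isometry commuting with [V], and a bounded sequence solves the equation
    with forcing term [y] modulo null sequences iff [S x - V x = y] in the
    quotient. The key fact is that [S - V] is bounded below.

    The first step is that the spectrum of [V] does not meet the unit circle at
    all. If [l - V] has dense range then it is onto. Otherwise blocks with worse
    and worse solutions could be concatenated into one sequence that cannot be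
    approximated ([block_solvable]); so all finite blocks are approximately
    solvable with one bound, and, the kernel being summable, the solutions on
    longer and longer blocks are glued by a moving average ([approx_solvable])
    and corrected by iteration ([surj_of_approx]). If [l - V] is onto but not
    injective, the same holds for all nearby points ([kernel_stable]), so that the
    spectrum contains an arc of the circle and is not countable there. Hence
    [l - V] is invertible at each point of the circle ([res_invertible]),
    uniformly by compactness ([circle_invertible_unif]).

    The second step replaces Liouville's theorem by a finite Fourier argument.
    If [S x = V x], then [f(l) = (l - V)^-1 x] satisfies [S f(l) = l f(l) - x], so
    [S] shifts the Fourier coefficients of [f] over the roots of unity of a
    given even order, apart from a jump by [x] at one index; as [S] is an isometry
    these coefficients have constant norm, and as [f] is Lipschitz the middle one
    is small, whence [x = 0]. Done quantitatively, this bounds [x] by [S x - V x]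
    ([isometry_sub_bounded_below], [Sbar_sub_Vbar_bounded_below]).

    This gives (ii) at once, and (i) because contractivity makes all solutions
    bounded. For (iii), the forcing term is approximated by trigonometric
    polynomials. For each exponential forcing the solution in the quotient is an
    eigenvector of [S], so it varies slowly after rotation and may be replaced by
    an exact exponential ([exponential_approx]). Hence a bounded solution is, in
    the quotient, a limit of trigonometric polynomials. Trigonometric polynomials
    recur, so their norms in the quotient and over all integers agree
    ([rnorm_trig]), and the approximations converge uniformly on the integers to
    an almost periodic sequence. *)

Set Implicit Arguments.
Unset Strict Implicit.
Unset Printing Implicit Defensive.

Import Order.TTheory GRing.Theory Num.Theory.
Import numFieldNormedType.Exports.

Local Open Scope classical_set_scope.
Local Open Scope complex_scope.
Local Open Scope ring_scope.

(** * Real-valued norms and geometric series *)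

Section CabsTheory.
Context {R : realType}.
Implicit Types z w : R[i].

Lemma cabsM z w : cabs (z * w) = cabs z * cabs w.
Proof. by apply: complexI; rewrite rmorphM/= -!cabsE normrM. Qed.

Lemma cabs1 : cabs (1 : R[i]) = 1.
Proof. by rewrite /cabs normr1. Qed.

Lemma cabsN z : cabs (- z) = cabs z.
Proof. by rewrite /cabs normrN. Qed.

Lemma cabsV z : cabs z^-1 = (cabs z)^-1.
Proof. by apply: complexI; rewrite -cabsE normfV cabsE fmorphV. Qed.

Lemma cabsX z n : cabs (z ^+ n) = cabs z ^+ n.
Proof. by elim: n => [|n IH]; rewrite ?expr0 ?cabs1// !exprS cabsM IH. Qed.

Lemma cabsD z w : cabs (z + w) <= cabs z + cabs w.
Proof. by rewrite -lecR rmorphD/= -!cabsE ler_normD. Qed.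

Lemma cabs_real (r : R) : cabs r%:C = `|r|.
Proof.
apply: complexI; rewrite -cabsE; have [r0|/ltW r0] := leP 0 r.
  by rewrite !ger0_norm// lecR.
by rewrite !ler0_norm ?lecR// rmorphN.
Qed.

Lemma normc1_cabs z : `|z| = 1 -> cabs z = 1.
Proof. by move=> z1; rewrite /cabs z1. Qed.

Lemma cabs1_normc z : cabs z = 1 -> `|z| = 1.
Proof. by move=> z1; rewrite cabsE z1. Qed.

Lemma cabs1_neq0 z : cabs z = 1 -> z != 0.
Proof.
by move=> z1; apply/eqP => z0; move/eqP: z1; rewrite z0 cabs0 eq_sym oner_eq0.
Qed.

End CabsTheory.

Section RnormTheory.
Context {R : realType} {E : normedModType R[i]}.
Implicit Types x y : E.

Lemma rnormB x y : rnorm (x - y) <= rnorm x + rnorm y.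
Proof. by rewrite (le_trans (rnormD _ _))// rnormN. Qed.

Lemma rdistC x y : rnorm (x - y) = rnorm (y - x).
Proof. by rewrite -rnormN opprB. Qed.

Lemma rdistD y x z : rnorm (x - z) <= rnorm (x - y) + rnorm (y - z).
Proof. by rewrite -[x - z](subrKA y) rnormD. Qed.

Lemma rnorm_sum_le n (u : nat -> E) (a : R) :
  (forall k, (k < n)%N -> rnorm (u k) <= a) ->
  rnorm (\sum_(k < n) u k) <= n%:R * a.
Proof.
elim: n => [|n IH] ua; first by rewrite big_ord0 rnorm0 mul0r.
rewrite big_ord_recr/= (le_trans (rnormD _ _))// -natr1 mulrDl mul1r.
by rewrite lerD ?ua// IH// => k kn; apply: ua; rewrite ltnW.
Qed.

Lemma rnorm_sum n (u : nat -> E) :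
  rnorm (\sum_(k < n) u k) <= \sum_(k < n) rnorm (u k).
Proof.
elim: n => [|n IH]; first by rewrite !big_ord0 rnorm0.
by rewrite !big_ord_recr/= (le_trans (rnormD _ _))// lerD2r.
Qed.

(** The mean of finitely many vectors of norm at most [a] has norm at most
    [a]. *)
Lemma rnorm_mean_le n (u : nat -> E) (a : R) : 0 <= a ->
  (forall k, (k < n)%N -> rnorm (u k) <= a) ->
  rnorm ((n%:R^-1)%:C *: \sum_(k < n) u k) <= a.
Proof.
move=> a0 ua; rewrite rnormZ cabs_real ger0_norm ?invr_ge0//.
have [->|n0] := posnP n; first by rewrite invr0 mul0r.
by rewrite ler_pdivrMl ?ltr0n// rnorm_sum_le.
Qed.

Lemma rnorm_le0 x : (forall e, 0 < e -> rnorm x <= e) -> x = 0.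
Proof.
move=> xe; apply: rnorm0_eq0; apply/eqP; rewrite eq_le rnorm_ge0 andbT.
by apply/ler_addgt0Pr => e e0; rewrite add0r xe.
Qed.

(** Convergence of geometrically dominated series: the form in which the
    completeness of a space is used throughout. *)
Definition geo_complete := forall (c : R) (u : nat -> E),
  (forall k, rnorm (u k) <= c / 2 ^+ k) ->
  exists s, forall n, rnorm (s - \sum_(k < n) u k) <= 2 * c / 2 ^+ n.

End RnormTheory.
Arguments geo_complete {R} E.

Lemma geo_small (R : realType) (c e : R) : 0 <= c -> 0 < e ->
  exists N, forall n, (N <= n)%N -> c / 2 ^+ n <= e.
Proof.
move=> c0 e0; exists (Num.truncn (c / e)).+1 => n Nn.
rewrite ler_pdivrMr ?exprn_gt0// mulrC -ler_pdivrMr//.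
apply: (@le_trans _ _ n%:R); last by rewrite -natrX ler_nat ltnW// ltn_expl.
apply: (@le_trans _ _ (Num.truncn (c / e)).+1%:R); last by rewrite ler_nat.
by rewrite ltW// truncnS_gt.
Qed.

Lemma geo_partial_dist (R : realType) (E : normedModType R[i]) (c : R)
    (u : nat -> E) (n m : nat) : (forall k, rnorm (u k) <= c / 2 ^+ k) ->
  (n <= m)%N ->
  rnorm (\sum_(k < m) u k - \sum_(k < n) u k) <= 2 * c / 2 ^+ n.
Proof.
move=> uc; have c0 : 0 <= c.
  by rewrite -[c]divr1 -(expr0 2) (le_trans (rnorm_ge0 _) (uc 0)).
move=> nm; rewrite -(subnKC nm); move: (m - n)%N => p {m nm}.
suff: rnorm (\sum_(k < n + p) u k - \sum_(k < n) u k)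
    <= 2 * c / 2 ^+ n - 2 * c / 2 ^+ (n + p).
  move/le_trans; apply; rewrite lerBlDr lerDl.
  by rewrite divr_ge0 ?mulr_ge0 ?exprn_ge0.
elim: p => [|p IH]; first by rewrite addn0 !subrr rnorm0.
rewrite addnS big_ord_recr/= addrAC (le_trans (rnormD _ _))//.
rewrite (le_trans (lerD IH (uc _)))//.
have h : 0 < 2 ^+ (n + p) :> R by rewrite exprn_gt0.
suff -> : 2 * c / 2 ^+ (n + p).+1 = c / 2 ^+ (n + p) by lra.
by rewrite exprS; field; rewrite gt_eqF.
Qed.

Lemma complete_geo_complete (R : realType) (X : completeNormedModType R[i]) :
  geo_complete X.
Proof.
move=> c u uc; have c0 : 0 <= c.
  by rewrite -[c]divr1 -(expr0 2) (le_trans (rnorm_ge0 _) (uc 0)).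
pose S n : X := \sum_(k < n) u k.
have : cauchy (S @ \oo).
  apply: cauchy_exP => e e0; have er0 : 0 < complex.Re e.
    by rewrite -ltcR ReK_ge0// ltW.
  have [||N HN] := @geo_small R (2 * c) (complex.Re e / 2).
  - by rewrite mulr_ge0.
  - by rewrite divr_gt0.
  exists (S N); exists N => // n /= Nn.
  rewrite -ball_normE /= distrC rnormE -[e]ReK_ge0 ?ltW// ltcR.
  rewrite (le_lt_trans (geo_partial_dist uc Nn))// (le_lt_trans (HN N _))//.
  by rewrite ltr_pdivrMr// ltr_pMr// ltr1n.
move=> /cauchy_cvgP Sc; exists (lim (S @ \oo)) => n.
apply/ler_addgt0Pr => e e0.
have /cvgrPdist_le /(_ e%:C) := Sc; rewrite ltcR => /(_ e0)[N _ HN].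
have := HN (maxn N n) (leq_maxl _ _); rewrite rnormE lecR => h.
rewrite (le_trans (rdistD (S (maxn N n)) _ _))// addrC lerD//.
by apply: geo_partial_dist => //; exact: leq_maxr.
Qed.

Section BoundedSequences.
Context {R : realType} {I : Type} {X : normedModType R[i]}.

Lemma linf_of_bound (f : I -> X) (M : R) : (forall i, rnorm (f i) <= M) ->
  exists x : linf I X, forall i, x i = f i.
Proof.
move=> fM; have fb : f \in bounded_pred by apply/bounded_predP; exists M.
by exists (Linf fb).
Qed.

Lemma linfBE (x y : linf I X) i : (x - y) i = x i - y i. Proof. by []. Qed.

Lemma linfZE (l : R[i]) (x : linf I X) i : (l *: x) i = l *: x i.
Proof. by []. Qed.

Lemma linf_sumE n (u : nat -> linf I X) i :
  (\sum_(k < n) u k : linf I X) i = \sum_(k < n) u k i.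
Proof.
by elim: n => [|n IH]; rewrite ?big_ord0// !big_ord_recr/= -IH.
Qed.

Lemma linf_geo_complete : geo_complete X -> geo_complete (linf I X).
Proof.
move=> gX c u uc; have c0 : 0 <= c.
  by rewrite -[c]divr1 -(expr0 2) (le_trans (rnorm_ge0 _) (uc 0)).
have ui i k : rnorm (u k i) <= c / 2 ^+ k.
  exact: le_trans (rnorm_le_supnorm _ _) (uc k).
have /choice[s Hs] i : exists s, forall n,
    rnorm (s - \sum_(k < n) u k i) <= 2 * c / 2 ^+ n.
  exact: (gX c (fun k => u k i)).
have [|x xs] := @linf_of_bound s (2 * c).
  by move=> i; have := Hs i 0; rewrite big_ord0 subr0 expr0 divr1.
exists x => n; apply: supnorm_le => [|i].
  by rewrite divr_ge0 ?mulr_ge0 ?exprn_ge0.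
by rewrite linfBE linf_sumE xs.
Qed.

End BoundedSequences.

(** * The quotient by null sequences *)

Section QuotientTheory.
Context {R : realType} {X : normedModType R[i]}.
Local Notation linf := (linf nat X).
Local Notation quo := (linf_mod_c0 X).

Lemma clsN (x : linf) : cls (- x) = - cls x.
Proof. by rewrite -scaleN1r clsZ scaleN1r. Qed.

Lemma clsB (x y : linf) : cls (x - y) = cls x - cls y.
Proof. by rewrite clsD clsN. Qed.

Lemma cls_sum n (u : nat -> linf) :
  cls (\sum_(k < n) u k) = \sum_(k < n) cls (u k).
Proof.
elim: n => [|n IH]; first by rewrite !big_ord0 cls0.
by rewrite !big_ord_recr/= clsD IH.
Qed.

Lemma c0P (x : linf) : reflect
  (forall e : R, 0 < e -> exists N, forall n, (N <= n)%N -> rnorm (x n) <= e)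
  (x \in c0_pred).
Proof.
apply: (iffP (c0_predP x)) => [/cvgrPdist_le x0 e e0|x0].
  have [|N _ HN] := x0 e%:C; first by rewrite ltcR.
  by exists N => n /HN; rewrite sub0r normrN rnormE lecR.
apply/cvgrPdist_le => e e0; have er0 : 0 < complex.Re e.
  by rewrite -ltcR ReK_ge0// ltW.
have [N HN] := x0 _ er0; exists N => // n /HN.
by rewrite sub0r normrN rnormE -{2}(ReK_ge0 (ltW e0)) lecR.
Qed.

Lemma cls_eqP (x y : linf) :
  (forall e : R, 0 < e ->
     exists N, forall n, (N <= n)%N -> rnorm (x n - y n) <= e) ->
  cls x = cls y.
Proof. by move=> h; apply/clsP/c0P. Qed.

Lemma cls_eq0P (x : linf) : cls x = 0 -> x \in c0_pred.
Proof. by rewrite -cls0 => /clsP; rewrite subr0. Qed.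

(** The quotient norm is the upper limit of the norms of the terms; this lemma
    and the next express it by eventual upper bounds. *)
Lemma rnorm_cls_le (x : linf) (M : R) N : 0 <= M ->
  (forall n, (N <= n)%N -> rnorm (x n) <= M) -> rnorm (cls x) <= M.
Proof.
move=> M0 xM.
have [|y yx] := @linf_of_bound _ _ _ (fun n => if (N <= n)%N then x n else 0) M.
  by move=> n; case: ifP => [/xM//|_]; rewrite rnorm0.
have <- : cls y = cls x.
  apply: cls_eqP => e e0; exists N => n Nn.
  by rewrite yx Nn subrr rnorm0 ltW.
rewrite (le_trans (quonorm_le _))// supnorm_le// => n.
by rewrite yx; case: ifP => [/xM//|_]; rewrite rnorm0.
Qed.

Lemma rnorm_cls_lt (x : linf) (M : R) : rnorm (cls x) < M ->
  exists N, forall n, (N <= n)%N -> rnorm (x n) <= M.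
Proof.
move=> xM; have [_ [y yx <-] yM] : exists2 r,
    [set supnorm z | z in [set z : linf | cls z = cls x]] r & r < M.
  apply: inf_lt => //; exists (supnorm x), x => //=.
have /c0P/(_ (M - supnorm y)) : x - y \in c0_pred by apply/clsP.
rewrite subr_gt0 => /(_ yM)[N HN]; exists N => n /HN h.
rewrite -[x n](subrK (y n)) (le_trans (rnormD _ _))//.
by rewrite -[M](subrK (supnorm y)) lerD// rnorm_le_supnorm.
Qed.

Lemma cls_lift (q : quo) (M : R) : rnorm q < M ->
  exists2 x, cls x = q & supnorm x <= M.
Proof.
move=> qM; have [_ [y yq <-] yM] : exists2 r,
    [set supnorm z | z in [set z : linf | cls z = q]] r & r < M.
  apply: inf_lt => //; exists (supnorm (rep q)), (rep q) => //=.
  exact: repK.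
by exists y => //; exact: ltW.
Qed.

Lemma quo_geo_complete : geo_complete X -> geo_complete quo.
Proof.
move=> gX c u uc; have c0 : 0 <= c.
  by rewrite -[c]divr1 -(expr0 2) (le_trans (rnorm_ge0 _) (uc 0)).
(* The lifts only satisfy the bound up to [e], so the partial sums are compared
   with a limit that does not depend on [e]. *)
have lift (e : R) : 0 < e -> exists s, forall n,
    rnorm (s - \sum_(k < n) u k) <= 2 * (c + e) / 2 ^+ n.
  move=> e0; have /choice[v Hv] k : exists v : linf,
      cls v = u k /\ supnorm v <= (c + e) / 2 ^+ k.
    have [|v vu vk] := @cls_lift (u k) ((c + e) / 2 ^+ k); last by exists v.
    by rewrite (le_lt_trans (uc k))// ltr_pM2r ?invr_gt0 ?exprn_gt0// ltrDl.
  have [|s Hs] := @linf_geo_complete R nat X gX (c + e) v.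
    by move=> k; have [_] := Hv k.
  exists (cls s) => n.
  have -> : \sum_(k < n) u k = cls (\sum_(k < n) v k).
    by rewrite cls_sum; apply: eq_bigr => k _; have [->] := Hv k.
  by rewrite -clsB (le_trans (quonorm_le _))//; exact: Hs.
have [s Hs] := lift 1 ltr01.
exists s => n; apply/ler_addgt0Pr => e e0.
have [t Ht] := lift (e / 2) (divr_gt0 e0 (ltr0n _ 2)).
have <- : t = s.
  apply/eqP; rewrite -subr_eq0; apply/eqP/rnorm_le0 => d d0.
  pose C := 2 * (c + e / 2) + 2 * (c + 1).
  have [||N HN] := @geo_small R C d => //.
    by rewrite /C !(addr_ge0, mulr_ge0)// ?divr_ge0// ltW.
  rewrite (le_trans _ (HN N (leqnn _)))//.
  rewrite (le_trans (rdistD (\sum_(k < N) u k) _ _))// mulrDl lerD//.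
  by rewrite rdistC.
rewrite (le_trans (Ht n))// mulrDr mulrDl lerD2l mulrCA divff// mulr1.
by rewrite ler_pdivrMr ?exprn_gt0// ler_peMr ?exprn_ege1 ?ler1n// ltW.
Qed.

End QuotientTheory.

(** * Volterra operators with summable kernels *)

Local Notation conv := Defs.conv.

Section SummableKernel.
Context {R : realType} {X : normedModType R[i]}.
Variables (A : {linear X -> X}) (B : nat -> {linear X -> X}).
Hypotheses (cA : continuous A) (cB : forall k, continuous (B k)).

Lemma summable_tail :
  (\sum_(0 <= k <oo) (opnorm (B k))%:E < +oo)%E ->
  (exists2 S : R, 0 <= S & forall n, \sum_(k < n) opnorm (B k) <= S) /\
  (forall e : R, 0 < e ->
     exists M, forall n, \sum_(M <= k < n) opnorm (B k) <= e).
Proof.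
move=> sB; have b0 k : 0 <= opnorm (B k) by exact: opnorm_ge0.
pose S : R := fine (\sum_(0 <= k <oo) (opnorm (B k))%:E)%E.
have SE : (S%:E = \sum_(0 <= k <oo) (opnorm (B k))%:E)%E.
  rewrite /S fineK// ge0_fin_numE// nneseries_ge0// => k _ _.
  by rewrite lee_fin.
have Sle n : \sum_(0 <= k < n) opnorm (B k) <= S.
  rewrite -lee_fin -sumEFin SE; apply: nneseries_lim_ge => k _ _.
  by rewrite lee_fin.
have Scvg : (\sum_(0 <= k < n) opnorm (B k)) @[n --> \oo] --> S.
  have : (\sum_(0 <= k < n) (opnorm (B k))%:E)%E @[n --> \oo] --> S%:E.
    by rewrite SE; apply: is_cvg_nneseries => k _ _; rewrite lee_fin.
  move=> /fine_cvg; apply: cvg_trans; apply: near_eq_cvg; near=> n.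
  by rewrite /= sumEFin.
split.
  exists S => [|n]; last by rewrite -(big_mkord xpredT (fun k => opnorm (B k))).
  by apply: le_trans (Sle 0); rewrite big_nil.
move=> e e0; move/cvgrPdist_le : Scvg => /(_ e e0)[M _ HM].
exists M => n; have [Mn|nM] := leqP M n; last first.
  by rewrite big_geq 1?ltnW// ltW.
rewrite -(lerD2l (\sum_(0 <= k < M) opnorm (B k))) -big_cat_nat//=.
rewrite (le_trans (Sle n))// -lerBlDl (le_trans (ler_norm _))//.
exact: HM (leqnn M).
Unshelve. all: by end_near. Qed.

Lemma ksum_le (S a : R) M (d : nat -> X) : 0 <= a ->
  (forall n, \sum_(k < n) opnorm (B k) <= S) ->
  (forall k, (k < M)%N -> rnorm (d k) <= a) ->
  rnorm (\sum_(k < M) B k (d k)) <= S * a.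
Proof.
move=> a0 SB da; rewrite (le_trans (rnorm_sum M (fun k => B k (d k))))//.
apply: (@le_trans _ _ (\sum_(k < M) opnorm (B k) * a)).
  apply: ler_sum => k _; rewrite (le_trans (le_opnorm _ (@cB k)))//.
  by rewrite ler_wpM2l ?opnorm_ge0// da.
by rewrite -mulr_suml ler_wpM2r.
Qed.

Lemma conv_trunc (K e : R) M n (x : nat -> X) : (M <= n.+1)%N ->
  (forall m, rnorm (x m) <= K) ->
  (forall n, \sum_(M <= k < n) opnorm (B k) <= e) ->
  rnorm (conv B x n - \sum_(k < M) B k (x (n - k)%N)) <= e * K.
Proof.
move=> Mn xK tail; rewrite /conv.
rewrite -(big_mkord xpredT (fun k => B k (x (n - k)%N))).
rewrite -[X in _ - X](big_mkord xpredT (fun k => B k (x (n - k)%N))).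
rewrite (@big_cat_nat _ _ _ M)//= addrAC subrr add0r.
apply: (@le_trans _ _ (\sum_(M <= k < n.+1) opnorm (B k) * K)).
  elim/big_ind2 : _ => [|u p v q up vq|k _]; first by rewrite rnorm0.
    by rewrite (le_trans (rnormD _ _))// lerD.
  rewrite (le_trans (le_opnorm _ (@cB k)))//.
  by rewrite ler_wpM2l ?opnorm_ge0.
by rewrite -mulr_suml ler_wpM2r// (le_trans (rnorm_ge0 _) (xK 0)).
Qed.

(** [(l - V) x] for an arbitrary, possibly unbounded, sequence [x]. *)
Definition resop (l : R[i]) (x : nat -> X) (n : nat) : X :=
  l *: x n - A (x n) - conv B x n.

Lemma conv_is_linear n : linear ((conv B)^~ n : (nat -> X) -> X).
Proof.
move=> l x y; rewrite /conv scaler_sumr -big_split; apply: eq_bigr => k _.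
by rewrite /= linearP.
Qed.

Lemma resop_is_linear l n : linear ((resop l)^~ n : (nat -> X) -> X).
Proof.
have addrACA3 (V : zmodType) (p q r s t w : V) :
    p + q + (r + s) + (t + w) = p + r + t + (q + s + w).
  by rewrite (addrACA p q) (addrACA (p + r)).
move=> a x y; rewrite /resop conv_is_linear (linearP A)/= scalerDr !opprD.
by rewrite !scalerBr !scalerA mulrC; exact: addrACA3.
Qed.

End SummableKernel.

(** * Dense range implies surjectivity on the quotient *)

Section DenseRange.
Context {R : realType} {X : normedModType R[i]}.
Variables (A : {linear X -> X}) (B : nat -> {linear X -> X}) (l : R[i]).
Hypotheses (cB : forall k, continuous (B k)).
Local Notation W := (resop A B l).

(** Finite blocks of vectors can be placed one after the other, arbitrarily far
    away, in a single sequence. *)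
Lemma concat_blocks (L : nat -> nat) (z : nat -> nat -> X) (M : R) : 0 <= M ->
  (forall j n, rnorm (z j n) <= M) ->
  exists (Z : nat -> X) (p : nat -> nat), [/\ forall j, (j <= p j)%N,
    forall n, rnorm (Z n) <= M &
    forall j m, (m < L j)%N -> Z (p j + m)%N = z j m].
Proof.
move=> M0 zM; pose p j := (\sum_(i < j) (L i).+1)%N.
have pS j : p j.+1 = (p j + (L j).+1)%N by rewrite /p big_ord_recr.
have pmono i j : (i <= j)%N -> (p i <= p j)%N.
  move=> ij; rewrite -(subnKC ij); elim: (j - i)%N => [|d IH].
    by rewrite addn0.
  by rewrite addnS pS (leq_trans IH)// leq_addr.
have pge j : (j <= p j)%N by elim: j => // j IH; rewrite pS; lia.
have uniq_j i j m m' : (m < L i)%N -> (m' < L j)%N ->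
    (p i + m = p j + m')%N -> i = j.
  move=> mi mj e; have [ij|ji|//] := ltngtP i j.
    by have := pmono _ _ ij; rewrite pS; lia.
  by have := pmono _ _ ji; rewrite pS; lia.
have /choice[Z HZ] n : exists v, rnorm v <= M /\
    forall j m, (m < L j)%N -> n = (p j + m)%N -> v = z j m.
  have [[j [m [mj nE]]]|no] :=
      pselect (exists j m, (m < L j)%N /\ n = (p j + m)%N).
    exists (z j m); split=> // j' m' mj' nE'.
    have ij : j = j' by apply: (uniq_j _ _ m m') => //; rewrite -nE.
    by subst j'; congr z; lia.
  exists 0; split=> [|j m mj nE]; first by rewrite rnorm0.
  by case: no; exists j, m.
exists Z, p; split=> // [n|j m mj]; first by have [] := HZ n.
by have [_] := HZ (p j + m)%N; apply.
Qed.

(** If the range of [l - V] is dense modulo null sequences, then every finite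
    block of norm at most one is approximately solvable somewhere on the time
    axis, with a bound that does not depend on the block: otherwise the
    concatenation of worse and worse blocks would not be approximated. *)
Lemma block_solvable (e : R) : 0 < e ->
  (forall z : linf nat X, exists x : linf nat X, exists N,
     forall n, (N <= n)%N -> rnorm (W x n - z n) <= e) ->
  exists2 K : R, 0 < K & forall N (z : nat -> X), (forall n, rnorm (z n) <= 1) ->
    exists p (x : nat -> X), (forall n, rnorm (x n) <= K) /\
      forall n, (n < N)%N -> rnorm (W x (p + n) - z n) <= e.
Proof.
move=> e0 dns; apply: contrapT => /forall2NP no.
have /choice[f Hf] j : exists f : nat * (nat -> X),
    (forall n, rnorm (f.2 n) <= 1) /\
    forall p x, (forall n, rnorm (x n) <= j.+1%:R) ->
      exists2 n, (n < f.1)%N & e < rnorm (W x (p + n) - f.2 n).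
  have [|nj] := no j.+1%:R; first by rewrite ltr0n.
  apply: contrapT => nof; apply: nj => N z z1; apply: contrapT => nopx.
  apply: nof; exists (N, z); split=> //= p x xj; apply: contrapT => non.
  apply: nopx; exists p, x; split=> // n nN; rewrite leNgt; apply/negP => en.
  by apply: non; exists n.
have [||Z [p [pge Z1 Zp]]] :=
  @concat_blocks (fun j => (f j).1) (fun j => (f j).2) 1 => //.
  by move=> j n; have [] := Hf j.
have [z zZ] := linf_of_bound Z1; have [x [N Hx]] := dns z.
pose j := maxn (Num.truncn (supnorm x)) N.
have [_ /(_ (p j) x)[n|n nL]] := Hf j.
  rewrite (le_trans (rnorm_le_supnorm _ _))// (le_trans (ltW (truncnS_gt _)))//.
  by rewrite ler_nat ltnS leq_maxl.
rewrite ltNge; apply/negP/negPn; rewrite -(Zp _ _ nL) -zZ; apply: Hx.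
by rewrite (leq_trans (leq_maxr _ _) (leq_trans (pge j) _))// leq_addr.
Qed.

Lemma resop_shift (K e : R) M n p (x : nat -> X) : (M <= n)%N ->
  (forall m, rnorm (x m) <= K) ->
  (forall n, \sum_(M <= k < n) opnorm (B k) <= e) ->
  rnorm (W (fun m => x (p + m)%N) n - W x (p + n)) <= 2 * (e * K).
Proof.
move=> Mn xK tail; rewrite /resop opprB addrC subrKA.
rewrite (le_trans (rdistD (\sum_(k < M) B k (x (p + n - k)%N)) _ _))//.
rewrite mulr_natl mulr2n lerD//.
  by apply: conv_trunc => //; lia.
rewrite rdistC [X in _ - X](_ : _ = \sum_(k < M) B k (x (p + (n - k))%N)).
  by apply: (conv_trunc cB _ (x := fun m => x (p + m)%N)) => //; lia.
apply: eq_bigr => k _; rewrite addnBA//.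
by rewrite (leq_trans (ltnW (ltn_ord k))).
Qed.

(** Since the kernel is summable, [W] almost commutes with passing to the
    diagonal of a slowly varying family of sequences. *)
Lemma resop_diag (K S e d : R) M n (b : nat -> nat -> X) : (M <= n)%N ->
  (forall n, \sum_(k < n) opnorm (B k) <= S) ->
  (forall n, \sum_(M <= k < n) opnorm (B k) <= e) ->
  (forall n m, rnorm (b n m) <= K) ->
  (forall n m, rnorm (b n.+1 m - b n m) <= d) ->
  rnorm (W (fun m => b m m) n - W (b n) n) <= 2 * (e * K) + S * (M%:R * d).
Proof.
move=> Mn SB tail bK bd; have d0 : 0 <= d.
  exact: le_trans (rnorm_ge0 _) (bd 0%N 0%N).
have bdk k i m : rnorm (b (i + k)%N m - b i m) <= k%:R * d.
  elim: k => [|k IH]; first by rewrite addn0 subrr rnorm0 mul0r.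
  rewrite addnS (le_trans (rdistD (b (i + k)%N m) _ _))//.
  by rewrite -natr1 mulrDl mul1r addrC lerD.
rewrite /resop opprB addrC subrKA.
pose u := \sum_(k < M) B k (b n (n - k)%N).
pose v := \sum_(k < M) B k (b (n - k)%N (n - k)%N).
rewrite (le_trans (rdistD u _ _))//.
have -> : 2 * (e * K) + S * (M%:R * d) = e * K + (S * (M%:R * d) + e * K).
  by ring.
rewrite lerD//; first by apply: conv_trunc => //; lia.
rewrite (le_trans (rdistD v _ _))// lerD//; last first.
  rewrite rdistC; apply: (conv_trunc cB _ (x := fun m => b m m)) => //.
  by lia.
rewrite /u /v -sumrB.
under eq_bigr do rewrite -linearB.
apply: (@ksum_le _ _ _ cB S _ M (fun k => b n (n - k)%N - b (n - k)%N (n - k)%N)).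
- by rewrite mulr_ge0.
- by [].
- move=> k kM; have {1}-> : n = (n - k + k)%N by rewrite subnK//; lia.
  by rewrite (le_trans (bdk _ _ _))// ler_wpM2r// ler_nat ltnW.
Qed.

(** Approximate solvability on blocks gives, for each [j], a sequence [x j] that
    solves approximately from some fixed time [M] up to time [j].  The sequence
    whose [n]-th term is the mean of the [x j n] for [n <= j < n + L] then solves
    approximately at all times from [M] on: it is the diagonal of a family that
    varies slowly when [L] is large. *)
Lemma approx_solvable
  (sB : (\sum_(0 <= k <oo) (opnorm (B k))%:E < +oo)%E) :
  (forall (e : R) (z : linf nat X), 0 < e -> exists x : linf nat X, exists N,
     forall n, (N <= n)%N -> rnorm (W x n - z n) <= e) ->
  exists2 K : R, 0 < K & forall z : linf nat X, (forall n, rnorm (z n) <= 1) ->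
    exists x : linf nat X, (forall n, rnorm (x n) <= K) /\
      exists N, forall n, (N <= n)%N -> rnorm (W x n - z n) <= 4^-1.
Proof.
move=> dns; have [[S S0 SB] tailB] := summable_tail cB sB.
have e0 : 0 < 16^-1 :> R by rewrite invr_gt0.
have [K K0 HK] := block_solvable e0 (fun z => dns _ z e0).
exists K => // z z1.
have [|M HM] := tailB (16^-1 / (2 * K)); first by rewrite divr_gt0 ?mulr_gt0.
have eK : 2 * (16^-1 / (2 * K) * K) = 16^-1 :> R.
  by field; rewrite gt_eqF.
have /choice[x Hx] j : exists x : nat -> X, (forall n, rnorm (x n) <= K) /\
    forall n, (M <= n <= j)%N -> rnorm (W x n - z n) <= 8^-1.
  have [p [x [xK xz]]] := HK j.+1 z z1.
  exists (fun m => x (p + m)%N); split=> // n /andP[Mn nj].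
  rewrite (le_trans (rdistD (W x (p + n)) _ _))//.
  have -> : 8^-1 = 16^-1 + 16^-1 :> R by field.
  apply: lerD; last exact: xz.
  by rewrite -[leRHS]eK; apply: (resop_shift _ _ xK HM).
(* L is the length of the averaging window. *)
pose L := (Num.truncn (32 * (S * M%:R * K))).+1.
have L0 : 0 < L%:R :> R by rewrite ltr0n.
pose b n m : X := (L%:R^-1)%:C *: \sum_(j < L) x (n + j)%N m.
have bK n m : rnorm (b n m) <= K.
  rewrite /b; apply: (@rnorm_mean_le _ _ L (fun j => x (n + j)%N m)).
    exact: ltW.
  by move=> j _; have [] := Hx (n + j)%N.
have bd n m : rnorm (b n.+1 m - b n m) <= 2 * K / L%:R.
  rewrite /b -scalerBr rnormZ cabs_real ger0_norm ?invr_ge0// mulrC.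
  rewrite ler_wpM2r ?invr_ge0//.
  have -> : \sum_(j < L) x (n.+1 + j)%N m - \sum_(j < L) x (n + j)%N m =
      x (n + L)%N m - x n m.
    rewrite -(big_mkord xpredT (fun j => x (n.+1 + j)%N m)).
    rewrite -(big_mkord xpredT (fun j => x (n + j)%N m)) -sumrB.
    under eq_bigr do rewrite addSnnS.
    by rewrite (telescope_sumr (fun j => x (n + j)%N m))// addn0.
  rewrite (le_trans (rnormB _ _))// mulr_natl mulr2n.
  by rewrite lerD//; [have [] := Hx (n + L)%N | have [] := Hx n].
have [y yb] := linf_of_bound (fun m => bK m m).
exists y; split=> [n|]; first by rewrite yb.
exists M => n Mn; have -> : (y : nat -> X) = fun m => b m m by apply/funext.
rewrite (le_trans (rdistD (W (b n) n) _ _))//.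
have -> : 4^-1 = 8^-1 + 8^-1 :> R by field.
apply: lerD.
  have -> : 8^-1 = 16^-1 + 16^-1 :> R by field.
  rewrite (le_trans (resop_diag Mn SB HM bK bd))// eK lerD2l.
  rewrite !mulrA ler_pdivrMr//.
  have := truncnS_gt (32 * (S * M%:R * K)); rewrite -/L; lra.
have -> : W (b n) n - z n =
    (L%:R^-1)%:C *: \sum_(j < L) (W (x (n + j)%N) n - z n).
  rewrite sumrB scalerBr; congr (_ - _); last first.
    rewrite sumr_const card_ord -scalerMnr scalerMnl.
    by rewrite -rmorphMn/= -mulr_natr mulVf ?gt_eqF// scale1r.
  pose Wl : {linear (nat -> X) -> X} := HB.pack_for {linear (nat -> X) -> X}
    (fun y : nat -> X => W y n)
    (GRing.isLinear.Build _ _ _ _ _ (@resop_is_linear R X A B l n)).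
  rewrite (_ : b n = (L%:R^-1)%:C *: \sum_(j < L) x (n + j)%N).
    by rewrite -[LHS]/(Wl _) linearZ linear_sum.
  apply/funext => m; rewrite /b -[RHS]/(_ *: _); congr (_ *: _).
  by elim/big_ind2 : _ => // u v u' v' -> ->.
apply: (@rnorm_mean_le _ _ L (fun j => W (x (n + j)%N) n - z n)).
  by rewrite invr_ge0.
by move=> j _; have [_] := Hx (n + j)%N; apply; rewrite Mn leq_addr.
Qed.

End DenseRange.

(** * Bounded operators with approximate solutions, and isometries *)

Section Operators.
Context {R : realType} {E : normedModType R[i]}.
Implicit Types T S : {linear E -> E}.

Lemma surj_of_approx T (K M : R) : geo_complete E -> 0 <= K -> 0 <= M ->
  (forall x, rnorm (T x) <= M * rnorm x) ->
  (forall z, exists x,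
     rnorm x <= K * rnorm z /\ rnorm (z - T x) <= rnorm z / 2) ->
  forall z, exists x, T x = z /\ rnorm x <= 2 * K * rnorm z.
Proof.
move=> gE K0 M0 TM /choice[f Hf] z.
pose r n := iter n (fun r => r - T (f r)) z.
have rn n : rnorm (r n) <= rnorm z / 2 ^+ n.
  elim: n => [|n IH]; first by rewrite expr0 divr1.
  rewrite (le_trans (proj2 (Hf (r n))))// exprSr invfM mulrA.
  by rewrite ler_wpM2r.
have [|x Hx] := gE (K * rnorm z) (fun n => f (r n)).
  by move=> k; rewrite (le_trans (proj1 (Hf _)))// -mulrA ler_wpM2l.
have part n : T (\sum_(k < n) f (r k)) = z - r n.
  elim: n => [|n IH]; first by rewrite big_ord0 linear0 subrr.
  by rewrite big_ord_recr/= linearD IH opprB addrA [RHS]addrAC addrC.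
exists x; split; last first.
  by have := Hx 0%N; rewrite big_ord0 subr0 expr0 divr1 mulrA.
apply/eqP; rewrite -subr_eq0; apply/eqP/rnorm_le0 => e e0.
have [||N HN] := @geo_small R (M * (2 * (K * rnorm z)) + rnorm z) e => //.
  by rewrite addr_ge0 ?mulr_ge0// rnorm_ge0.
rewrite (le_trans _ (HN N (leqnn _)))//.
have -> : T x - z = T (x - \sum_(k < N) f (r k)) - r N.
  by rewrite linearB part opprB addrA addrAC addrK.
rewrite (le_trans (rnormB _ _))// mulrDl lerD//.
by rewrite (le_trans (TM _))// -mulrA ler_wpM2l.
Qed.

(** The kernel of a surjective operator is stable under small perturbations of
    the operator by scalars. *)
Lemma kernel_stable T (K M : R) (d : R[i]) (v : E) : geo_complete E ->
  0 <= K -> 0 <= M -> (forall x, rnorm (T x) <= M * rnorm x) ->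
  (forall z, exists x, T x = z /\ rnorm x <= K * rnorm z) ->
  v != 0 -> T v = 0 -> cabs d * K <= 4^-1 ->
  exists2 u, u != 0 & T u = d *: u.
Proof.
move=> gE K0 M0 TM /choice[f Hf] v0 Tv dK.
have fd z : rnorm (d *: f z) <= rnorm z / 4.
  rewrite rnormZ (le_trans (ler_wpM2l (cabs_ge0 _) (proj2 (Hf z))))//.
  by rewrite mulrA mulrC ler_wpM2l ?rnorm_ge0.
pose w n := iter n (fun z => d *: f z) (d *: f v).
have wn n : rnorm (w n) <= rnorm v / 4 / 2 ^+ n.
  elim: n => [|n IH]; first by rewrite expr0 divr1 fd.
  rewrite (le_trans (fd _))// exprSr invfM [leRHS]mulrA ler_pM//.
    exact: rnorm_ge0.
  by rewrite lef_pV2 ?posrE// ler_nat.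
have [s Hs] := gE _ _ wn.
have part n : T (\sum_(k < n.+1) w k) = d *: (v + \sum_(k < n) w k).
  elim: n => [|n IH].
    by rewrite big_ord1 big_ord0 addr0/= linearZ/= (proj1 (Hf v)).
  rewrite big_ord_recr/= linearD IH big_ord_recr/= addrA [in RHS]scalerDr.
  by rewrite linearZ/= (proj1 (Hf _)).
have sv : rnorm s <= rnorm v / 2.
  have := Hs 0%N; rewrite big_ord0 subr0 expr0 divr1 => /le_trans; apply.
  by rewrite le_eqVlt; apply/orP; left; apply/eqP; field.
have v0' : 0 < rnorm v.
  rewrite lt_neqAle rnorm_ge0 andbT eq_sym; apply: contraNneq v0 => v0'.
  by rewrite (rnorm0_eq0 v0').
exists (v + s).
  apply/negP => /eqP vs; have : v = - s by apply/eqP; rewrite -addr_eq0 vs.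
  move=> vs'; move: sv; rewrite -(rnormN s) -vs'; lra.
rewrite linearD Tv add0r; apply/eqP; rewrite -subr_eq0; apply/eqP/rnorm_le0.
move=> e e0; pose C := 2 * (rnorm v / 4).
have C0 : 0 <= C by rewrite mulr_ge0 ?divr_ge0 ?rnorm_ge0.
have [||N HN] := @geo_small R (M * C + cabs d * C) e => //.
  by apply: addr_ge0; apply: mulr_ge0 => //; exact: cabs_ge0.
rewrite (le_trans _ (HN N (leqnn _)))//.
have -> : T s - d *: (v + s) = T (s - \sum_(k < N.+1) w k)
     - d *: (s - \sum_(k < N) w k).
  rewrite linearB part -addrA -opprD -scalerDr; congr (_ - d *: _).
  by rewrite addrACA subrr addr0.
rewrite (le_trans (rnormB _ _))// mulrDl lerD//.
  rewrite (le_trans (TM _))// -mulrA ler_wpM2l// (le_trans (Hs _))//.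
  rewrite -/C ler_wpM2l// lef_pV2 ?posrE ?exprn_gt0// exprS.
  by rewrite ler_peMl ?exprn_ge0// ler1n.
by rewrite rnormZ -mulrA ler_wpM2l ?cabs_ge0// Hs.
Qed.

Lemma root_sum (w : R[i]) h k : w ^+ h = -1 -> w ^+ k != 1 ->
  \sum_(j < 2 * h) w ^+ (j * k) = 0.
Proof.
move=> wh wk; apply: (mulfI (x := w ^+ k - 1)); first by rewrite subr_eq0.
rewrite mulr0; under eq_bigr do rewrite mulnC exprM.
by rewrite -subrX1 -exprM mulnC exprM mulnC exprM wh sqrrN expr1n expr1n subrr.
Qed.

(** Let [T] commute with the isometry [S], and suppose that [w ^+ j - T] is
    invertible, with inverse of norm at most [C], at all the [2 * h]-th roots of
    unity.  If these are close enough together, then [S - T] is bounded below.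
    Up to errors controlled by [S x - T x], the discrete Fourier coefficients
    [c k] of [w ^+ j |-> (w ^+ j - T)^-1 x] satisfy [S (c k) = c k.+1] for
    [0 < k < 2 * h] and [S (c 0) = c 1 - x].  So [c 1], ..., [c (2 * h) = c 0]
    have about the same norm, which is small because the sum defining [c h]
    alternates; hence [x = c 1 - S (c 0)] is small. *)
Lemma isometry_sub_bounded_below T S (C : R) (w : R[i]) h :
  (0 < h)%N -> 0 <= C ->
  (forall x, rnorm (S x) = rnorm x) -> (forall x, S (T x) = T (S x)) ->
  cabs w = 1 -> w ^+ h = -1 ->
  (forall k, (0 < k < 2 * h)%N -> w ^+ k != 1) ->
  (forall j x, exists u, w ^+ j *: u - T u = x) ->
  (forall j u, rnorm u <= C * rnorm (w ^+ j *: u - T u)) ->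
  cabs (w - 1) * C ^+ 2 <= 2^-1 ->
  forall x, rnorm x <= 2 * ((2 * h + 1)%:R * C) * rnorm (S x - T x).
Proof.
move=> h0 C0 Siso ST w1 wh wk surj bnd close x.
set eta := S x - T x.
have cw k : cabs (w ^+ k) = 1 by rewrite cabsX w1 expr1n.
have w2h k : w ^+ (k * (2 * h)) = 1.
  by rewrite mulnA mulnC exprM wh mulnC exprM sqrrN !expr1n.
have /choice[f Hf] j := surj j x.
have /choice[g Hg] j := surj j eta.
have fC j : rnorm (f j) <= C * rnorm x by rewrite -{1}(Hf j) bnd.
have gC j : rnorm (g j) <= C * rnorm eta by rewrite -{1}(Hg j) bnd.
have resB j u v : w ^+ j *: (u - v) - T (u - v) =
    (w ^+ j *: u - T u) - (w ^+ j *: v - T v).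
  by rewrite (linearB T) scalerBr !opprD !opprK addrACA.
have Sf j : S (f j) = w ^+ j *: f j - x + g j.
  have -> : w ^+ j *: f j - x = T (f j) by rewrite -{1}(Hf j) subKr.
  suff /eqP : S (f j) - T (f j) - g j = 0.
    by rewrite subr_eq0 subr_eq addrC => /eqP.
  apply/rnorm0_eq0/eqP; rewrite eq_le rnorm_ge0 andbT (le_trans (bnd j _))//.
  have PS : w ^+ j *: S (f j) - T (S (f j)) = S x.
    by rewrite -ST -[in RHS](Hf j) (linearB S) linearZ.
  have PT : w ^+ j *: T (f j) - T (T (f j)) = T x.
    by rewrite -[in RHS](Hf j) (linearB T) linearZ.
  by rewrite !resB PS PT Hg subrr rnorm0 mulr0.
have fdist j : rnorm (f j - f j.+1) <= rnorm x / 2.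
  rewrite (le_trans (bnd j.+1 _))// resB (Hf j.+1) -{1}(Hf j) opprB subrKA.
  rewrite -scalerBl exprS -[X in _ - X]mul1r -mulrBl rnormZ cabsM cw mulr1.
  rewrite (@le_trans _ _ (C * (cabs (w - 1) * (C * rnorm x))))//.
    by rewrite ler_wpM2l// ler_wpM2l// ?cabs_ge0.
  have -> : C * (cabs (w - 1) * (C * rnorm x)) =
    rnorm x * (cabs (w - 1) * C ^+ 2) by ring.
  by rewrite ler_wpM2l ?rnorm_ge0.
pose m := (2 * h)%N; have m0 : m%:R != 0 :> R by rewrite pnatr_eq0; lia.
pose c k := (m%:R^-1)%:C *: \sum_(j < m) w ^+ (j * k) *: f j.
pose d k := (m%:R^-1)%:C *: \sum_(j < m) w ^+ (j * k) *: g j.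
pose dl k : R[i] := (m%:R^-1)%:C * \sum_(j < m) w ^+ (j * k).
have dC k : rnorm (d k) <= C * rnorm eta.
  apply: (@rnorm_mean_le _ _ m (fun j => w ^+ (j * k) *: g j)).
    by rewrite mulr_ge0 ?rnorm_ge0.
  by move=> j _; rewrite rnormZ cw mul1r.
have Sc k : S (c k) = c k.+1 - dl k *: x + d k.
  rewrite /c /d /dl -scalerA -scalerBr -scalerDr linearZ/=; congr (_ *: _).
  rewrite linear_sum scaler_suml -sumrB -big_split; apply: eq_bigr => j _ /=.
  by rewrite linearZ/= Sf scalerDr scalerBr scalerA -exprD mulnS addnC.
have dl0 k : (0 < k < m)%N -> dl k = 0.
  by move=> km; rewrite /dl root_sum ?mulr0// wk.
have ch : rnorm (c h) <= rnorm x / 4.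
  have alt n : \sum_(j < 2 * n) w ^+ (j * h) *: f j =
      \sum_(i < n) (f (2 * i)%N - f (2 * i).+1).
    elim: n => [|n IH]; first by rewrite muln0 !big_ord0.
    rewrite mulnS add2n !big_ord_recr/= IH -addrA; congr (_ + _).
    have sgn k : w ^+ (k * h) = (-1) ^+ k by rewrite mulnC exprM wh.
    by rewrite !sgn exprS exprM sqrrN !expr1n mulr1 scale1r scaleN1r.
  rewrite /c /m alt rnormZ cabs_real ger0_norm ?invr_ge0//.
  have h0' : 0 < h%:R :> R by rewrite ltr0n.
  rewrite natrM ler_pdivrMl ?mulr_gt0//.
  rewrite (le_trans (rnorm_sum_le (a := rnorm x / 2)
    (u := fun i => f (2 * i)%N - f (2 * i).+1) _))//.
  by rewrite le_eqVlt; apply/orP; left; apply/eqP; field.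
have cup i : (i <= h)%N ->
    rnorm (c (h + i)%N) <= rnorm x / 4 + i%:R * (C * rnorm eta).
  elim: i => [|i IH] ih; first by rewrite addn0 mul0r addr0.
  have := Sc (h + i)%N; rewrite dl0 ?scale0r ?subr0; last by rewrite /m; lia.
  move=> /eqP; rewrite -subr_eq addnS => /eqP <-.
  rewrite (le_trans (rnormB _ _))// Siso -[i.+1%:R]natr1 mulrDl mul1r addrA lerD//.
  by rewrite IH// ltnW.
have cdown i : (i < h)%N ->
    rnorm (c (h - i)%N) <= rnorm x / 4 + i%:R * (C * rnorm eta).
  elim: i => [|i IH] ih; first by rewrite subn0 mul0r addr0.
  rewrite -Siso Sc dl0 ?scale0r ?subr0; last by rewrite /m; lia.
  rewrite (le_trans (rnormD _ _))// -[i.+1%:R]natr1 mulrDl mul1r addrA lerD//.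
  have -> : (h - i.+1).+1 = (h - i)%N by lia.
  by rewrite IH// ltnW.
have c0 : rnorm (c 0%N) <= rnorm x / 4 + h%:R * (C * rnorm eta).
  have -> : c 0%N = c (h + h)%N; last exact: cup.
  rewrite /c; congr (_ *: _); apply: eq_bigr => j _.
  by rewrite muln0 expr0 addnn -mul2n w2h.
have c1 : rnorm (c 1%N) <= rnorm x / 4 + h%:R * (C * rnorm eta).
  have := cdown h.-1; rewrite (_ : (h - h.-1)%N = 1%N); last by lia.
  rewrite ltn_predL h0 => /(_ isT)/le_trans; apply.
  by rewrite lerD2l ler_wpM2r ?mulr_ge0 ?rnorm_ge0// ler_nat leq_pred.
have dl1 : dl 0%N = 1.
  rewrite /dl; under eq_bigr do rewrite muln0 expr0.
  by rewrite sumr_const card_ord mulr_natr -rmorphMn/= -mulr_natr mulVf.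
have xE : x = c 1%N + d 0%N - S (c 0%N).
  by rewrite Sc dl1 scale1r (addrAC (c 1%N) (- x)) subKr.
have : rnorm x <= rnorm (c 1%N) + C * rnorm eta + rnorm (c 0%N).
  rewrite {1}xE (le_trans (rnormB _ _))// Siso lerD2r.
  by rewrite (le_trans (rnormD _ _))// lerD2l.
rewrite natrD natrM.
have : 0 <= C * rnorm eta by rewrite mulr_ge0 ?rnorm_ge0.
move: c0 c1; set a := rnorm (c 0%N); set b := rnorm (c 1%N).
rewrite -mulrA -[(_ * C) * _]mulrA; move: (C * rnorm eta) => q.
move: (h%:R : R) => H; lra.
Qed.

End Operators.

(** * The points of the unit circle *)

Section UnitCircle.
Context {R : realType}.
Implicit Types s t : R.

(** The point [e^(it)] of the unit circle. *)
Definition expi t : R[i] := cos t +i* sin t.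

Lemma cabs_expi t : cabs (expi t) = 1.
Proof. by rewrite /cabs /expi normc_def /= cos2Dsin2 sqrtr1. Qed.

Lemma expi0 : expi 0 = 1.
Proof. by rewrite /expi cos0 sin0. Qed.

Lemma expiD s t : expi (s + t) = expi s * expi t.
Proof.
rewrite /expi cosD sinD; apply/eqP; rewrite eq_complex /= eqxx /=.
by rewrite [X in _ == X]addrC.
Qed.

Lemma expiX t n : expi t ^+ n = expi (n%:R * t).
Proof.
elim: n => [|n IH]; first by rewrite expr0 mul0r expi0.
by rewrite exprS IH -expiD -natr1 mulrDl mul1r addrC.
Qed.

Lemma expi_pi : expi pi = -1.
Proof. by apply/eqP; rewrite /expi cospi sinpi eq_complex /= oppr0 !eqxx. Qed.

Lemma expi_neq1 t : 0 < t < 2 * pi -> expi t != 1.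
Proof.
move=> t2; apply/negP => /eqP[ct st].
have : 0 < sin (t / 2).
  by apply: sin_gt0_pi; move: t2; lra.
have := cos2Dsin2 (t / 2); have := cosD (t / 2) (t / 2).
rewrite -splitr ct; move: (sin _) (cos _) => a b; nra.
Qed.

Lemma expi_inj : {in `[0, 1] &, injective expi}.
Proof.
have h x : x \in `[0, 1] -> x \in `[0, pi : R].
  by rewrite !in_itv/=; have := @pi_ge2 R; lra.
by move=> s t s1 t1 [+ _]; apply: cos_inj; exact: h.
Qed.

Lemma cabs_le_ReIm (z : R[i]) : cabs z <= `|complex.Re z| + `|complex.Im z|.
Proof.
case: z => a b; have {1}-> : a +i* b = a%:C + 'i%C * b%:C.
  by apply/eqP; rewrite eq_complex /=; apply/andP; split; apply/eqP; ring.
rewrite (le_trans (cabsD _ _))// cabsM !cabs_real.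
by rewrite {1}/cabs normc_def /= expr0n expr1n add0r sqrtr1 mul1r.
Qed.

Lemma expi_near1 (e : R) : 0 < e ->
  exists2 d : R, 0 < d & forall s, `|s| < d -> cabs (expi s - 1) <= e.
Proof.
move=> e0; have e2 : 0 < e / 2 by rewrite divr_gt0.
have /cvgrPdist_le /(_ _ e2) := @continuous_cos R 0.
rewrite cos0 => /nbhs_ballP[d1 /= d10 H1].
have /cvgrPdist_le /(_ _ e2) := @continuous_sin R 0.
rewrite sin0 => /nbhs_ballP[d2 /= d20 H2].
exists (Num.min d1 d2) => [|s]; first by rewrite lt_min d10.
rewrite lt_min => /andP[s1 s2]; rewrite (le_trans (cabs_le_ReIm _))//=.
rewrite [e]splitr lerD//.
  by rewrite distrC; apply: H1; rewrite -ball_normE /= sub0r normrN.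
rewrite oppr0 addr0 -normrN -sub0r.
by apply: H2; rewrite -ball_normE /= sub0r normrN.
Qed.

Lemma cabs_expiB s t : cabs (expi s - expi t) = cabs (expi (s - t) - 1).
Proof.
have -> : expi s = expi (s - t) * expi t by rewrite -expiD subrK.
by rewrite -{2}[expi t]mul1r -mulrBl cabsM cabs_expi mulr1.
Qed.

(** No arc of the circle is countable. *)
Lemma uncountable_arc (l : R[i]) (d : R) (D : set R[i]) : l != 0 -> 0 < d ->
  (forall s, 0 <= s < d -> D (l * expi s)) -> ~ countable D.
Proof.
move=> l0 d0 HD cD; pose a := Num.min (d / 2) 1.
have a0 : 0 < a by rewrite lt_min divr_gt0/=.
have a1 : a <= 1 by rewrite ge_min lexx orbT.
have ad : a < d.
  rewrite (@le_lt_trans _ _ (d / 2))// ?ge_min ?lexx//.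
  by rewrite ltr_pdivrMr// ltr_pMr// ltr1n.
have : countable `[0, a].
  apply: (@card_le_trans _ _ _ D) => //.
  have inj : {in `[0, a]%classic &, injective (fun s => l * expi s)}.
    move=> s t /set_mem s1 /set_mem t1; move: s1 t1; rewrite /= !in_itv/=.
    move=> /andP[s0 sa] /andP[t0 ta] /(mulfI l0); apply: expi_inj.
      by rewrite in_itv/= s0 (le_trans sa).
    by rewrite in_itv/= t0 (le_trans ta).
  have /card_eqPle[_ h] := inj_card_eq inj.
  apply: (card_le_trans h); apply: subset_card_le => _ [s + <-].
  by rewrite /= in_itv/= => /andP[s0 sa]; apply: HD; rewrite s0 (le_lt_trans sa).
move=> /countable_lebesgue_measure0; rewrite lebesgue_measure_itv/= lte_fin a0.
by rewrite oppr0 adde0 => -[a00]; move: a0; rewrite a00 ltxx.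
Qed.

End UnitCircle.

(** * The induced operator and the shift on the quotient *)

Section Shift.
Context {R : realType} {X : normedModType R[i]}.
Local Notation linf := (linf nat X).
Local Notation quo := (linf_mod_c0 X).

Lemma seqshift_bounded (x : linf) : (fun n => x n.+1) \in bounded_pred.
Proof. by apply/bounded_predP; exists (supnorm x) => n; exact: rnorm_le_supnorm. Qed.

(** The left shift [x(0), x(1), ... |-> x(1), x(2), ...]. *)
Definition seqshift (x : linf) : linf := Linf (seqshift_bounded x).

Lemma seqshift_is_linear : linear seqshift.
Proof. by move=> l x y; apply: linfP. Qed.

Lemma rnorm_cls_seqshift (x : linf) : rnorm (cls (seqshift x)) = rnorm (cls x).
Proof.
apply/eqP; rewrite eq_le; apply/andP; split; apply/ler_addgt0Pr => e e0.
  have [|N HN] := @rnorm_cls_lt _ _ x (rnorm (cls x) + e); first by rewrite ltrDl.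
  apply: (@rnorm_cls_le _ _ _ _ N) => [|n Nn].
    by rewrite addr_ge0 ?rnorm_ge0 ?ltW.
  by apply: HN; rewrite ltnW.
have [|N HN] := @rnorm_cls_lt _ _ (seqshift x) (rnorm (cls (seqshift x)) + e).
  by rewrite ltrDl.
apply: (@rnorm_cls_le _ _ _ _ N.+1) => [|[//|n] Nn].
  by rewrite addr_ge0 ?rnorm_ge0 ?ltW.
exact: HN.
Qed.

(** The shift induced on the quotient; it does not depend on the choice of
    representatives, see [Sbar_cls]. *)
Definition Sbar (q : quo) : quo := cls (seqshift (rep q)).

Lemma Sbar_cls x : Sbar (cls x) = cls (seqshift x).
Proof.
apply/eqP; rewrite -subr_eq0 -clsB; apply/eqP/rnorm0_eq0.
have -> : seqshift (rep (cls x)) - seqshift x = seqshift (rep (cls x) - x).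
  exact: linfP.
by rewrite rnorm_cls_seqshift clsB repK subrr rnorm0.
Qed.

Lemma Sbar_is_linear : linear Sbar.
Proof.
move=> l p q; rewrite -[p]repK -[q]repK -clsZ -clsD !Sbar_cls.
by rewrite seqshift_is_linear clsD clsZ.
Qed.

Lemma rnorm_Sbar q : rnorm (Sbar q) = rnorm q.
Proof. by rewrite -[q]repK Sbar_cls rnorm_cls_seqshift. Qed.

End Shift.

Section InducedOperator.
Context {R : realType} {X : completeNormedModType R[i]}.
Variables (A : {linear X -> X}) (B : nat -> {linear X -> X}).
Hypotheses (cA : continuous A) (cB : forall k, continuous (B k)).
Hypothesis sB : (\sum_(0 <= k <oo) (opnorm (B k))%:E < +oo)%E.
Local Notation linf := (linf nat X).
Local Notation quo := (linf_mod_c0 X).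
Local Notation Vb := (Vbar A B).
Local Notation Vcls := (Vbar_cls cA cB sB).

Lemma resopE l (x : linf) n : (l *: x - Vop A B x) n = resop A B l x n.
Proof. by rewrite linfBE linfZE (VopE cA cB sB) opprD addrA. Qed.

Lemma Vbar_Sbar q : Sbar (Vb q) = Vb (Sbar q).
Proof.
rewrite -[q]repK; move: (rep q) => x; rewrite Vcls !Sbar_cls Vcls.
apply: cls_eqP => e e0; have [[S S0 SB] tailB] := summable_tail cB sB.
have M0 : 0 <= supnorm x by exact: supnorm_ge0.
have [|M HM] := tailB (e / (2 * (supnorm x + 1))).
  by rewrite divr_gt0// mulr_gt0// ltr_wpDl.
exists M => n Mn; rewrite (_ : seqshift (Vop A B x) n = Vop A B x n.+1)//.
rewrite !(VopE cA cB sB) (_ : seqshift x n = x n.+1)// opprD addrACA subrr add0r.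
have eM : 2 * (e / (2 * (supnorm x + 1)) * supnorm x) <= e.
  rewrite (_ : _ * (_ * _) = e * (supnorm x / (supnorm x + 1))).
    rewrite ger_pMr// ler_pdivrMr ?mul1r ?ltr_wpDl//.
    by rewrite lerDl.
  by field; rewrite gt_eqF// ltr_wpDl.
rewrite (le_trans _ eM)// (le_trans (rdistD (\sum_(k < M) B k (x (n.+1 - k)%N)) _ _))//.
rewrite mulr_natl mulr2n lerD//.
  apply: conv_trunc => //; first by lia.
  by move=> m; exact: rnorm_le_supnorm.
rewrite rdistC [X in _ - X](_ : _ = \sum_(k < M) B k (seqshift x (n - k)%N)).
  apply: conv_trunc => //; first by lia.
  by move=> m; exact: (rnorm_le_supnorm x m.+1).
apply: eq_bigr => k _; congr (B k (x _)).
by rewrite subSn// (leq_trans (ltnW (ltn_ord k))).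
Qed.

Lemma res_is_linear l : linear (fun q : quo => l *: q - Vb q).
Proof.
move=> a p q; rewrite (Vbar_linear cA cB sB) scalerDr opprD addrACA scalerBr.
by rewrite !scalerA mulrC.
Qed.

Lemma res_bounded l : exists2 M : R, 0 <= M &
  forall q : quo, rnorm (l *: q - Vb q) <= M * rnorm q.
Proof.
pose M := opnorm A + fine (\sum_(0 <= k <oo) (opnorm (B k))%:E)%E.
exists (cabs l + `|M|) => [|q]; first by rewrite addr_ge0 ?cabs_ge0.
rewrite (le_trans (rnormB _ _))// rnormZ mulrDl lerD2l.
rewrite (le_trans (Vbar_le cA cB sB q))// ler_wpM2r ?rnorm_ge0//.
exact: ler_norm.
Qed.

Lemma dense_range_approx l :
  dense (range (fun q : quo => l *: q - Vb q)) ->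
  forall (e : R) (z : linf), 0 < e -> exists x : linf, exists N,
    forall n, (N <= n)%N -> rnorm (resop A B l x n - z n) <= e.
Proof.
move=> dns e z e0; have eC : 0 < e%:C by rewrite ltcR.
have [||p [pe [q _ pE]]] := dns (ball (cls z) e%:C).
- by exists (cls z); exact: ballxx.
- exact: ball_open.
move: pe; rewrite -pE -ball_normE /= rnormE ltcR -[q]repK.
move: (rep q) => x.
rewrite Vcls -clsZ -!clsB => /rnorm_cls_lt[N HN].
exists x, N => n Nn; rewrite -resopE rdistC; exact: HN.
Qed.

(** At a point of the circle where the range is dense, [l - V] is onto.  If it
    were not injective, the stability of kernels would put a whole arc starting
    at [l] in the spectrum, against countability. *)
Lemma res_invertible l : `|l| = 1 ->
  countable (spectrum Vb `&` unit_circle R) ->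
  dense (range (fun q : quo => l *: q - Vb q)) ->
  exists2 K : R, 0 <= K &
    (forall z : quo, exists q, l *: q - Vb q = z) /\
    (forall q : quo, rnorm q <= K * rnorm (l *: q - Vb q)).
Proof.
move=> l1 hcount dns; have gX := @complete_geo_complete R X.
have [K K0 HK] := approx_solvable cB sB (dense_range_approx dns).
pose T : {linear quo -> quo} := HB.pack_for {linear quo -> quo}
  (fun q : quo => l *: q - Vb q) (GRing.isLinear.Build _ _ _ _ _ (res_is_linear l)).
have [M M0 TM] := res_bounded l.
have surj : forall z : quo, exists q, T q = z /\ rnorm q <= 2 * (2 * K) * rnorm z.
  apply: (@surj_of_approx _ _ T (2 * K) M) => //.
  - exact: quo_geo_complete.
  - by rewrite mulr_ge0// ltW.
  move=> z; have [->|z0] := eqVneq z 0.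
    by exists 0; rewrite linear0 subrr rnorm0 mul0r mulr0.
  have z0' : 0 < rnorm z.
    rewrite lt_neqAle rnorm_ge0 andbT eq_sym; apply: contraNneq z0 => z0'.
    by rewrite (rnorm0_eq0 z0').
  have [|y yz ysup] := @cls_lift _ _ z (2 * rnorm z).
    by rewrite ltr_pMl// ltr1n.
  pose c := 2 * rnorm z; have c0 : 0 < c by rewrite mulr_gt0.
  have [|x [xK [N HN]]] := HK ((c^-1)%:C *: y).
    move=> n; rewrite linfZE rnormZ cabs_real gtr0_norm ?invr_gt0//.
    by rewrite ler_pdivrMl// mulr1 (le_trans (rnorm_le_supnorm _ _)).
  (* [y] may have norm up to [2 * rnorm z], so it is rescaled by [c]. *)
  exists (cls (c%:C *: x)); split.
    rewrite (le_trans (quonorm_le _))// -rnorm_linfE rnormZ cabs_real gtr0_norm//.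
    have -> : 2 * K * rnorm z = c * K by rewrite /c; ring.
    rewrite ler_wpM2l ?(ltW c0)//.
    by apply: supnorm_le => //; exact: ltW.
  have -> : rnorm z / 2 = c / 4 by rewrite /c; field.
  have Tc : T (cls x) = cls (l *: x - Vop A B x).
    by rewrite -[LHS]/(l *: cls x - Vb (cls x)) Vcls -clsZ -clsB.
  rewrite -yz clsZ (linearZ_LR T) Tc -[X in _ - X]clsZ -clsB.
  apply: (@rnorm_cls_le _ _ _ _ N) => [|n Nn]; first by rewrite divr_ge0// ltW.
  have := HN n Nn; rewrite linfZE => h; rewrite linfBE linfZE resopE.
  have -> : y n = c%:C *: ((c^-1)%:C *: y n).
    by rewrite scalerA -rmorphM divff ?gt_eqF// scale1r.
  by rewrite -scalerBr rnormZ cabs_real gtr0_norm// ler_wpM2l ?(ltW c0)// rdistC.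
have K4 : 0 <= 2 * (2 * K) by rewrite !mulr_ge0// ltW.
have inj v : T v = 0 -> v = 0.
  move=> Tv; apply/eqP; apply/negPn/negP => v0.
  have d0 : 0 < (4 * (2 * (2 * K)))^-1 by rewrite invr_gt0 !mulr_gt0.
  have [d dpos Hd] := expi_near1 d0.
  apply: (@uncountable_arc R l d (spectrum Vb `&` unit_circle R)) hcount => //.
    by rewrite -normr_gt0 l1.
  move=> s /andP[s0 sd]; split; last first.
    by rewrite /unit_circle /= cabsE cabsM (normc1_cabs l1) cabs_expi mulr1.
  have [|u u0 Tu] := @kernel_stable _ _ T (2 * (2 * K)) M (l * (1 - expi s)) v
      (quo_geo_complete gX) K4 M0 TM surj v0 Tv.
    rewrite cabsM (normc1_cabs l1) mul1r -cabsN opprB.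
    rewrite (le_trans (ler_wpM2r K4 (Hd s _)))// ?ger0_norm//.
    by rewrite le_eqVlt; apply/orP; left; apply/eqP; field; rewrite gt_eqF.
  case=> U [_ TU _]; move/eqP: u0; apply; rewrite -(TU u).
  rewrite (_ : _ - _ = 0) ?linear0//; apply/eqP; rewrite subr_eq0.
  move/eqP: Tu; rewrite /= mulrBr mulr1 scalerBl => /eqP /addrI /oppr_inj.
  by move=> ->.
exists (2 * (2 * K)) => //; split=> [z|q].
  by have [q [Tq _]] := surj z; exists q.
have [p [Tp pK]] := surj (T q).
have /eqP : T (p - q) = 0 by rewrite linearB Tp subrr.
by move=> /eqP/inj/eqP; rewrite subr_eq0 => /eqP pq; rewrite -{1}pq.
Qed.

Hypothesis hcount : countable (spectrum Vb `&` unit_circle R).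
Hypothesis hres : residual_spectrum Vb `&` unit_circle R = set0.

Lemma circle_invertible l : cabs l = 1 ->
  exists2 K : R, 0 <= K &
    (forall z : quo, exists q, l *: q - Vb q = z) /\
    (forall q : quo, rnorm q <= K * rnorm (l *: q - Vb q)).
Proof.
move=> l1; apply: res_invertible => //; first exact: cabs1_normc.
apply: contrapT => nd; suff : (set0 : set R[i]) l by [].
by rewrite -hres; split=> //; exact: cabs1_normc.
Qed.

Lemma circle_invertible_unif : exists2 C : R, 0 <= C & forall t,
  t \in `[0, 2 * pi] ->
  forall q : quo, rnorm q <= C * rnorm (expi t *: q - Vb q).
Proof.
have /compact_near_coveringP cov := @segment_compact R 0 (2 * pi).
have := @cov R (pinfty_nbhs R)
  (fun C t => forall q : quo, rnorm q <= C * rnorm (expi t *: q - Vb q)) _.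
case=> [t _|M [_ HM]].
  have [K K0 [_ HK]] := circle_invertible (cabs_expi t).
  have K1 : 0 < 2 * (K + 1) by rewrite mulr_gt0// ltr_wpDl.
  have [d d0 Hd] := @expi_near1 R (2 * (K + 1))^-1 (eqbRL (invr_gt0 _) K1).
  (* Near [t] the bound [K] deteriorates to at most [2 * (K + 1)]. *)
  exists (ball t d, [set C | 2 * (K + 1) < C]) => /=.
    split; first exact: nbhsx_ballx.
    by exists (2 * (K + 1)); split=> //; exact: num_real.
  move=> [s C] [/= st KC] q.
  have h : cabs (expi t - expi s) <= (2 * (K + 1))^-1.
    by rewrite cabs_expiB; apply: Hd; move: st; rewrite -ball_normE.
  have q1 : rnorm q <= K * (rnorm (expi s *: q - Vb q) + (2 * (K + 1))^-1 * rnorm q).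
    rewrite (le_trans (HK q))// ler_wpM2l//.
    have -> : expi t *: q - Vb q = (expi s *: q - Vb q) + (expi t - expi s) *: q.
      by rewrite scalerBl [RHS]addrC subrKA.
    by rewrite (le_trans (rnormD _ _))// lerD2l rnormZ ler_wpM2r ?rnorm_ge0.
  have Kh : K * ((2 * (K + 1))^-1 * rnorm q) <= rnorm q / 2.
    rewrite mulrA [leRHS]mulrC ler_wpM2r ?rnorm_ge0// ler_pdivrMr//.
    by rewrite mulrA mulVf// mul1r lerDl.
  have N0 := rnorm_ge0 (expi s *: q - Vb q).
  move: q1 Kh KC N0; rewrite mulrDr; nra.
exists (`|M| + 1) => [|t t2 q]; first by rewrite addr_ge0.
by apply: (HM (`|M| + 1)) => //; rewrite ltr_pwDr// ler_norm.
Qed.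

(** On the quotient, [S - V] is bounded below: this controls a bounded solution
    by its forcing term, modulo null sequences. *)
Lemma Sbar_sub_Vbar_bounded_below : exists2 C : R, 0 <= C &
  forall q : quo, rnorm q <= C * rnorm (Sbar q - Vb q).
Proof.
have [C C0 HC] := circle_invertible_unif.
have e0 : 0 < (2 * (C ^+ 2 + 1))^-1.
  by rewrite invr_gt0 mulr_gt0// ltr_wpDl// exprn_ge0.
have [d d0 Hd] := expi_near1 e0.
(* [h] makes consecutive [2 * h]-th roots of unity close enough together. *)
pose h := (Num.truncn (pi / d)).+1; have h0 : 0 < h%:R :> R by rewrite ltr0n.
have pd : pi / h%:R < d.
  by rewrite ltr_pdivrMr// mulrC -ltr_pdivrMr// truncnS_gt.
pose w := expi (pi / h%:R : R).
have wh : w ^+ h = -1 by rewrite /w expiX mulrC divfK ?gt_eqF// expi_pi.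
have w2h : w ^+ (2 * h) = 1 by rewrite mulnC exprM wh sqrrN expr1n.
pose T : {linear quo -> quo} := HB.pack_for {linear quo -> quo} Vb
  (GRing.isLinear.Build _ _ _ _ _ (Vbar_linear cA cB sB)).
pose S : {linear quo -> quo} := HB.pack_for {linear quo -> quo}
  (@Sbar R X) (GRing.isLinear.Build _ _ _ _ _ (@Sbar_is_linear R X)).
exists (2 * ((2 * h + 1)%:R * C)) => [|q]; first by rewrite !mulr_ge0.
apply: (@isometry_sub_bounded_below _ _ T S C w h) => //.
- exact: rnorm_Sbar.
- exact: Vbar_Sbar.
- exact: cabs_expi.
- move=> k /andP[k0 k2h]; rewrite /w expiX; apply: expi_neq1.
  have k0' : 0 < k%:R :> R by rewrite ltr0n.
  have p0 := pi_gt0 R.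
  rewrite mulrA divr_gt0 ?mulr_gt0//= ltr_pdivrMr// mulrAC.
  by rewrite ltr_pM2r// -natrM ltr_nat.
- move=> j x; have [|K _ [surj _]] := @circle_invertible (w ^+ j).
    by rewrite cabsX cabs_expi expr1n.
  exact: surj.
- move=> j u; rewrite -(expr_mod j w2h) /w expiX; apply: HC.
  rewrite in_itv/=; have p0 := pi_gt0 R.
  rewrite mulr_ge0 ?divr_ge0 ?(ltW p0)//= mulrA ler_pdivrMr// mulrAC.
  by rewrite ler_wpM2r ?(ltW p0)// -natrM ler_nat ltnW// ltn_pmod// muln_gt0.
- rewrite (@le_trans _ _ ((2 * (C ^+ 2 + 1))^-1 * C ^+ 2))//.
    rewrite ler_wpM2r ?exprn_ge0//; apply: Hd.
    by rewrite ger0_norm// divr_ge0 ?pi_ge0.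
  rewrite mulrC ler_pdivrMr ?mulr_gt0 ?ltr_wpDl ?exprn_ge0//.
  by rewrite mulrA mulVf// mul1r lerDl.
Qed.

End InducedOperator.

(** * Trigonometric polynomials *)

Section Recurrence.
Context {R : realType}.

Lemma normRe_le (z : R[i]) : `|complex.Re z| <= cabs z.
Proof.
case: z => a b; rewrite /cabs normc_def /= -sqrtr_sqr ler_wsqrtr//.
by rewrite lerDl sqr_ge0.
Qed.

Lemma normIm_le (z : R[i]) : `|complex.Im z| <= cabs z.
Proof.
case: z => a b; rewrite /cabs normc_def /= -sqrtr_sqr ler_wsqrtr//.
by rewrite lerDr sqr_ge0.
Qed.

Lemma truncn_eq_dist (x y : R) : 0 <= x -> 0 <= y ->
  Num.truncn x = Num.truncn y -> `|x - y| <= 1.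
Proof.
move=> /truncn_itv/andP[x1 x2] /truncn_itv/andP[y1 y2] xy.
by rewrite ler_norml; move: x1 x2 y1 y2; rewrite xy -natr1; lra.
Qed.

(** Pigeonhole principle on the unit circle: among boundedly many powers of
    a point, one comes back close to [1]. *)
Lemma circle_return (d : R) : 0 < d -> exists K, forall z : R[i], cabs z = 1 ->
  exists k, (0 < k <= K)%N /\ cabs (z ^+ k - 1) <= d.
Proof.
move=> d0; pose N := (Num.truncn (2 / d)).+1.
have N0 : 0 < N%:R :> R by rewrite ltr0n.
have Nd : 2 / N%:R <= d.
  by rewrite ler_pdivrMr// mulrC -ler_pdivrMr// ltW// truncnS_gt.
pose cell (a : R) : 'I_(2 * N).+1 := inord (Num.truncn ((a + 1) * N%:R)).
have cell_dist (a b : R) : `|a| <= 1 -> `|b| <= 1 -> cell a = cell b ->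
    `|a - b| <= N%:R^-1.
  move=> a1 b1 /(congr1 val); rewrite /cell.
  have pos (c : R) : `|c| <= 1 -> 0 <= (c + 1) * N%:R.
    by rewrite ler_norml => /andP[c1 _]; rewrite mulr_ge0 ?ler0n//; lra.
  have small (c : R) : `|c| <= 1 ->
      (Num.truncn ((c + 1) * N%:R) < (2 * N).+1)%N.
    move=> c1; rewrite ltnS -(ler_nat R) (@le_trans _ _ ((c + 1) * N%:R))//.
      by have := truncn_le ((c + 1) * N%:R); rewrite pos.
    rewrite natrM ler_wpM2r ?(ltW N0)//.
    by move: c1; rewrite ler_norml => /andP[_]; lra.
  rewrite /= !inordK ?small// => /(truncn_eq_dist (pos _ a1) (pos _ b1)).
  rewrite -mulrBl normrM [`|N%:R|]gtr0_norm// -ler_pdivlMr// div1r.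
  by rewrite opprD addrACA subrr addr0.
pose T : finType := ('I_(2 * N).+1 * 'I_(2 * N).+1)%type.
exists #|T| => z z1.
pose f (i : 'I_#|T|.+1) : T :=
  (cell (complex.Re (z ^+ i)), cell (complex.Im (z ^+ i))).
have zX n : cabs (z ^+ n) = 1 by rewrite cabsX z1 expr1n.
have close (i j : 'I_#|T|.+1) : (i < j)%N -> f i = f j ->
    exists k, (0 < k <= #|T|)%N /\ cabs (z ^+ k - 1) <= d.
  move=> ij [fRe fIm]; exists (j - i)%N; split.
    by rewrite subn_gt0 ij (leq_trans (leq_subr _ _))// -ltnS ltn_ord.
  have -> : cabs (z ^+ (j - i) - 1) = cabs (z ^+ i - z ^+ j).
    rewrite -(subnK (ltnW ij)) exprD -{1}[z ^+ i]mul1r -mulrBl cabsM zX mulr1.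
    by rewrite -cabsN opprB addnK.
  rewrite (le_trans (cabs_le_ReIm _))// (le_trans _ Nd)// -[2]/(1 + 1) mulrDl.
  rewrite mul1r !raddfB; apply: lerD.
    by apply: cell_dist; rewrite ?(le_trans (normRe_le _))// zX.
  by apply: cell_dist; rewrite ?(le_trans (normIm_le _))// zX.
have [i [j [ij fij]]] : exists i j : 'I_#|T|.+1, i != j /\ f i = f j.
  apply: contrapT => no; suff /leq_card : injective f.
    by rewrite card_ord ltnn.
  move=> i j fij; apply/eqP/negPn/negP => ij; apply: no; by exists i, j.
have [ltij|ltji|/val_inj eij] := ltngtP i j; first exact: close fij.
  exact: close (esym fij).
by rewrite eij eqxx in ij.
Qed.

(** Finitely many points of the circle have powers of a common, arbitrarily
    large, exponent close to [1]. *)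
Lemma simultaneous_return m (l : nat -> R[i]) (d : R) (N : nat) : 0 < d ->
  (forall j, cabs (l j) = 1) ->
  exists2 T, (N <= T)%N & forall j, (j < m)%N -> cabs (l j ^+ T - 1) <= d.
Proof.
move=> + l1; elim: m d => [|m IH] d d0; first by exists N.
have [K HK] := circle_return d0.
have [|T NT HT] := IH (d / K.+1%:R); first by rewrite divr_gt0 ?ltr0n.
have [|k [/andP[k0 kK] Hk]] := HK (l m ^+ T).
  by rewrite cabsX l1 expr1n.
exists (T * k)%N => [|j]; first by rewrite (leq_trans NT)// leq_pmulr.
rewrite ltnS leq_eqVlt => /orP[/eqP ->|jm]; first by rewrite exprM.
rewrite exprM; have {}HT := HT j jm; set z := l j ^+ T in HT *.
have z1 : cabs z = 1 by rewrite /z cabsX l1 expr1n.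
have : cabs (z ^+ k - 1) <= k%:R * (d / K.+1%:R).
  elim: k {k0 kK Hk} => [|k IHk]; first by rewrite expr0 subrr cabs0 mul0r.
  have -> : z ^+ k.+1 - 1 = z * (z ^+ k - 1) + (z - 1).
    by rewrite mulrBr mulr1 -exprS subrKA.
  rewrite (le_trans (cabsD _ _))// cabsM z1 mul1r -natr1 mulrDl mul1r.
  exact: lerD.
move=> /le_trans; apply; rewrite mulrCA ger_pMr// ler_pdivrMr ?ltr0n// mul1r.
by rewrite ler_nat ltnW.
Qed.

End Recurrence.

Section TrigonometricPolynomials.
Context {R : realType} {X : normedModType R[i]}.
Local Notation linf := (linf nat X).

Lemma cabs_exprz (l : R[i]) (n : int) : cabs l = 1 -> cabs (l ^ n) = 1.
Proof.
move=> l1; case: n => n; first by rewrite -exprnP cabsX l1 expr1n.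
by rewrite NegzE -exprnN cabsV cabsX l1 expr1n invr1.
Qed.

Lemma restr_bounded (v : Defs.linf int X) :
  (fun n : nat => v n%:Z) \in bounded_pred.
Proof. by apply/bounded_predP; exists (supnorm v) => n; exact: rnorm_le_supnorm. Qed.

(** The restriction to the natural numbers of a sequence indexed by the
    integers. *)
Definition restr (v : Defs.linf int X) : linf := Linf (restr_bounded v).

Lemma restrE v (n : nat) : restr v n = v n%:Z. Proof. by []. Qed.

Lemma restrB v w : restr (v - w) = restr v - restr w.
Proof. exact: linfP. Qed.

Lemma rnorm_cls_restr v : rnorm (cls (restr v)) <= rnorm v.
Proof.
rewrite (le_trans (quonorm_le _))// supnorm_le ?rnorm_ge0// => n.
exact: (rnorm_le_supnorm v n%:Z).
Qed.

(** Trigonometric polynomials [\sum_(j < m) l j ^ n *: y j] with frequencies on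
    the unit circle. *)
Definition trig (v : Defs.linf int X) := exists m (l : nat -> R[i]) (y : nat -> X),
  (forall j, cabs (l j) = 1) /\ forall n, v n = \sum_(j < m) l j ^ n *: y j.

Lemma trig_exists m (l : nat -> R[i]) (y : nat -> X) :
  (forall j, cabs (l j) = 1) ->
  exists v : Defs.linf int X, forall n, v n = \sum_(j < m) l j ^ n *: y j.
Proof.
move=> l1; apply: (@linf_of_bound _ _ _ _ (\sum_(j < m) rnorm (y j))) => n.
rewrite (le_trans (rnorm_sum m (fun j => l j ^ n *: y j)))//.
by apply: ler_sum => j _; rewrite rnormZ cabs_exprz// mul1r.
Qed.

Lemma span_trig v : linear_span ap_exponentials v -> trig v.
Proof.
case=> m [c [e [He ->]]].
have /choice[f Hf] j : exists f : R[i] * X,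
    `|f.1| = 1 /\ forall n, e j n = f.1 ^ n *: f.2.
  by have [l [y [l1 ey]]] := He j; exists (l, y).
pose fn (j : nat) := if insub j is Some i then f i else (1, 0).
pose cn (j : nat) := if insub j is Some i then c i else 0.
exists m, (fun j => (fn j).1), (fun j => cn j *: (fn j).2); split=> [j|n].
  rewrite /fn; case: insubP => [i _ _|_]; last by rewrite cabs1.
  by apply: normc1_cabs; have [] := Hf i.
have -> : (\sum_(j < m) c j *: e j) n = \sum_(j < m) c j *: e j n.
  by elim/big_rec2 : _ => //= j x y _ <-.
apply: eq_bigr => j _; rewrite /fn /cn valK.
by have [_ ->] := Hf j; rewrite !scalerA mulrC.
Qed.

Lemma trig_span v : trig v -> linear_span ap_exponentials v.
Proof.
case=> m [l [y [l1 vE]]].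
have /choice[e He] j : exists e : Defs.linf int X, forall n, e n = l j ^ n *: y j.
  apply: (@linf_of_bound _ _ _ _ (rnorm (y j))) => n.
  by rewrite rnormZ cabs_exprz// mul1r.
exists m, (fun=> 1), (fun j : 'I_m => e j); split=> [j|].
  by exists (l j), (y j); split=> //; exact: cabs1_normc.
apply: linfP => n; rewrite (linf_sumE m (fun j => 1 *: e j)) vE.
by apply: eq_bigr => j _; rewrite scale1r He.
Qed.

Lemma trigB v w : trig v -> trig w -> trig (v - w).
Proof.
case=> m [l [y [l1 vE]]] [p [k [z [k1 wE]]]].
exists (m + p)%N, (fun j => if (j < m)%N then l j else k (j - m)%N),
  (fun j => if (j < m)%N then y j else - z (j - m)%N).
split=> [j|n]; first by case: ifP.
rewrite linfBE vE wE big_split_ord /= -sumrN; congr (_ + _).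
  by apply: eq_bigr => j _; rewrite ltn_ord.
by apply: eq_bigr => j _; rewrite ltnNge leq_addr/= addKn scalerN.
Qed.

(** A trigonometric polynomial nearly repeats itself after suitable large
    times, so its supremum over the integers is its upper limit at infinity. *)
Lemma rnorm_trig v : trig v -> rnorm v <= rnorm (cls (restr v)).
Proof.
case=> m [l [y [l1 vE]]]; apply/ler_addgt0Pr => e e0.
have e2 : 0 < e / 2 by rewrite divr_gt0.
have [|N HN] := @rnorm_cls_lt _ _ (restr v) (rnorm (cls (restr v)) + e / 2).
  by rewrite ltrDl.
pose s := \sum_(j < m) rnorm (y j).
have s0 : 0 <= s by apply: sumr_ge0 => j _; exact: rnorm_ge0.
apply: supnorm_le => [|n]; first by rewrite addr_ge0 ?rnorm_ge0 ?ltW.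
have [|T NT HT] := @simultaneous_return R m l (e / 2 / (s + 1)) (N + `|n|) _ l1.
  by rewrite divr_gt0// ltr_wpDl.
have [p np Np] : exists2 p : nat, n + T%:Z = p%:Z & (N <= p)%N.
  by exists (absz (n + T%:Z)); lia.
rewrite -[v n](subrK (v (n + T%:Z))) (le_trans (rnormD _ _))//.
rewrite addrC [e in leRHS]splitr addrA lerD//; first by rewrite np; exact: HN.
rewrite !vE -sumrB.
rewrite (le_trans (rnorm_sum m (fun j => l j ^ n *: y j - l j ^ (n + T%:Z) *: y j)))//.
apply: (@le_trans _ _ (\sum_(j < m) e / 2 / (s + 1) * rnorm (y j))).
  apply: ler_sum => j _; rewrite expfzDr ?cabs1_neq0// -scalerBl.
  rewrite -{1}[l j ^ n]mulr1 -mulrBr rnormZ cabsM cabs_exprz// mul1r.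
  by rewrite ler_wpM2r ?rnorm_ge0// -cabsN opprB HT.
rewrite -mulr_sumr -/s mulrAC -mulrA ger_pMr// ler_pdivrMr ?ltr_wpDl//.
by rewrite mul1r lerDl.
Qed.

End TrigonometricPolynomials.

(** * Asymptotics of bounded solutions *)

Section Solutions.
Context {R : realType} {X : completeNormedModType R[i]}.
Variables (A : {linear X -> X}) (B : nat -> {linear X -> X}).
Hypotheses (cA : continuous A) (cB : forall k, continuous (B k)).
Hypothesis sB : (\sum_(0 <= k <oo) (opnorm (B k))%:E < +oo)%E.
Local Notation linf := (linf nat X).
Local Notation quo := (linf_mod_c0 X).
Local Notation Vb := (Vbar A B).
Hypothesis hcount : countable (spectrum Vb `&` unit_circle R).
Hypothesis hres : residual_spectrum Vb `&` unit_circle R = set0.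

Lemma exp_exists (l : R[i]) (y : X) : cabs l = 1 ->
  exists e : linf, forall n, e n = l ^+ n *: y.
Proof.
move=> l1; apply: (@linf_of_bound _ _ _ _ (rnorm y)) => n.
by rewrite rnormZ cabsX l1 expr1n mul1r.
Qed.

(** The class of a bounded sequence [u] solving [l u - V u = (l ^+ n y)] modulo
    null sequences is an eigenvector of the shift, that is,
    [l ^- n u n] varies slowly.  Hence, freezing it at a large time [p]
    gives an approximate solution that is an exact exponential. *)
Lemma exponential_approx (l : R[i]) (y : X) (e : R) : cabs l = 1 -> 0 < e ->
  exists x : X, exists N, forall n, (N <= n)%N ->
    rnorm (resop A B l (fun n => l ^+ n *: x) n - l ^+ n *: y) <= e.
Proof.
move=> l1 e0; have [g Hg] := exp_exists y l1.
have [C _ [surj bnd]] := circle_invertible cA cB sB hcount hres l1.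
have [q] := surj (cls g); rewrite -[q]repK; move: (rep q) => u uE.
have Su : Sbar (cls u) = l *: cls u.
  pose T : {linear quo -> quo} := HB.pack_for {linear quo -> quo}
    (fun q : quo => l *: q - Vb q)
    (GRing.isLinear.Build _ _ _ _ _ (res_is_linear cA cB sB l)).
  pose S : {linear quo -> quo} := HB.pack_for {linear quo -> quo}
    (@Sbar R X) (GRing.isLinear.Build _ _ _ _ _ (@Sbar_is_linear R X)).
  have Tu : T (cls u) = cls g by [].
  have TS c : T (S c) = S (T c).
    rewrite [T c]/(l *: c - Vb c) (linearB S) (linearZ_LR S).
    by rewrite -[LHS]/(l *: Sbar c - Vb (Sbar c)) -(Vbar_Sbar cA cB sB).
  have Sg : S (cls g) = l *: cls g.
    rewrite -[LHS]/(Sbar (cls g)) Sbar_cls -clsZ; congr cls; apply: linfP => n.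
    by rewrite linfZE Hg scalerA -exprS -Hg.
  apply/eqP; rewrite -subr_eq0; apply/eqP/rnorm0_eq0/eqP.
  rewrite eq_le rnorm_ge0 andbT (le_trans (bnd _))//.
  rewrite -[X in rnorm X]/(T (S (cls u) - l *: cls u)).
  by rewrite (linearB T) (linearZ_LR T) TS Tu Sg subrr rnorm0 mulr0.
have [[S S0 SB] tailB] := summable_tail cB sB.
pose K := supnorm u; have K0 : 0 <= K by exact: supnorm_ge0.
have uK m : rnorm (u m) <= K by exact: rnorm_le_supnorm.
have e4 : 0 < e / 4 by rewrite divr_gt0.
have [|M HM] := tailB (e / 4 / (K + 1)); first by rewrite divr_gt0// ltr_wpDl.
have eK : e / 4 / (K + 1) * K <= e / 4.
  by rewrite -mulrA ger_pMr// mulrC ler_pdivrMr ?ltr_wpDl// mul1r lerDl.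
pose d := e / 4 / (S * M%:R + 1).
have SM0 : 0 <= S * M%:R by rewrite mulr_ge0.
have d0 : 0 < d by rewrite divr_gt0// ltr_wpDl.
have SMd : S * (M%:R * d) <= e / 4.
  by rewrite mulrA mulrC -mulrA ger_pMr// mulrC ler_pdivrMr ?ltr_wpDl// mul1r lerDl.
have /cls_eq0P/c0P/(_ _ d0)[N1 HN1] : cls (seqshift u - l *: u) = 0.
  by rewrite clsB clsZ -Sbar_cls Su subrr.
have /cls_eq0P/c0P/(_ _ e4)[N2 HN2] : cls (l *: u - Vop A B u - g) = 0.
  by rewrite !clsB clsZ -(Vbar_cls cA cB sB) uE subrr.
(* From time [p - M] on, [u] is almost an eigenvector of the shift. *)
have [p [Mp N1p N2p]] : exists p,
    [/\ (M <= p)%N, forall k, (k <= M)%N -> (N1 <= p - k)%N & (N2 <= p)%N].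
  exists (maxn N1 N2 + M)%N; split=> [|k kM|]; first exact: leq_addl.
    by rewrite -addnBA// (leq_trans (leq_maxl N1 N2))// leq_addr.
  by rewrite (leq_trans (leq_maxr N1 N2))// leq_addr.
have slow k : (k <= M)%N -> rnorm (u p - l ^+ k *: u (p - k)%N) <= k%:R * d.
  elim: k => [|k IH] kM.
    by rewrite expr0 scale1r subn0 subrr rnorm0 mul0r.
  rewrite (le_trans (rdistD (l ^+ k *: u (p - k)%N) _ _))//.
  rewrite -natr1 mulrDl mul1r lerD ?IH 1?ltnW//.
  rewrite exprSr -scalerA -scalerBr rnormZ cabsX l1 expr1n mul1r.
  rewrite -(subnSK (leq_trans kM Mp)); exact/HN1/N1p.
have l0 : l != 0 by exact: cabs1_neq0.
exists (l ^- p *: u p), M => n Mn; pose r := l ^+ n * l ^- p.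
have r1 : cabs r = 1.
  by rewrite /r cabsM cabsV !cabsX l1 !expr1n invr1 mulr1.
pose E m := l ^+ m *: (l ^- p *: u p).
have EK m : rnorm (E m) <= K.
  by rewrite /E !rnormZ cabsV !cabsX l1 !expr1n invr1 !mul1r.
have En : E n = r *: u p by rewrite /E scalerA.
have -> : l ^+ n *: y = r *: (l ^+ p *: y).
  by rewrite scalerA /r -mulrA mulVf ?mulr1// expf_neq0.
rewrite -/E (le_trans (rdistD (r *: resop A B l u p) _ _))//.
have -> : e = (e / 4 + (e / 4 + e / 4)) + e / 4 by field.
apply: lerD; last first.
  rewrite -scalerBr rnormZ r1 mul1r -(resopE cA cB sB) -Hg -linfBE.
  exact: HN2.
have -> : resop A B l E n - r *: resop A B l u p =
    r *: conv B u p - conv B E n.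
  have ED : l *: E n - A (E n) = r *: (l *: u p - A (u p)).
    by rewrite En scalerBr (linearZ_LR A) !scalerA mulrC.
  by rewrite /resop ED [X in _ - X]scalerBr opprB addrC subrKA.
rewrite (le_trans (rdistD (r *: \sum_(k < M) B k (u (p - k)%N)) _ _))// lerD//.
  rewrite -scalerBr rnormZ r1 mul1r (le_trans _ eK)//.
  by apply: conv_trunc => //; exact: leqW.
rewrite (le_trans (rdistD (\sum_(k < M) B k (E (n - k)%N)) _ _))// lerD//; last first.
  by rewrite rdistC (le_trans _ eK)//; apply: conv_trunc => //; exact: leqW.
rewrite scaler_sumr -sumrB (le_trans _ SMd)//.
under eq_bigr do rewrite -linearZ -linearB.
apply: (@ksum_le _ _ _ cB S _ M (fun k => r *: u (p - k)%N - E (n - k)%N)) => //.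
  by rewrite mulr_ge0// ltW.
move=> k kM; have -> : E (n - k)%N = (r * l ^- k) *: u p.
  rewrite /E scalerA /r mulrAC; congr (_ * _ *: _).
  by rewrite expfB_cond// (negPf l0) (leq_trans (ltnW kM)).
rewrite -{1}[r]mulr1 -(mulVf (expf_neq0 k l0)) mulrA -[X in X - _]scalerA -scalerBr.
rewrite rnormZ cabsM r1 cabsV cabsX l1 expr1n invr1 !mul1r rdistC.
by rewrite (le_trans (slow _ (ltnW kM)))// ler_wpM2r ?(ltW d0)// ler_nat ltnW.
Qed.

(** Every trigonometric polynomial is, up to [e], a forcing term whose solution
    is again a trigonometric polynomial. *)
Lemma trig_approx (v : Defs.linf int X) (e : R) : trig v -> 0 < e ->
  exists2 P : Defs.linf int X, trig P &
    rnorm (Sbar (cls (restr P)) - Vb (cls (restr P)) - cls (restr v)) <= e.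
Proof.
case=> m [l [y [l1 vE]]] e0.
have e1 : 0 < e / m.+1%:R by rewrite divr_gt0 ?ltr0n.
have /choice[f Hf] j := exponential_approx (y j) (l1 j) e1.
have /choice[N HN] := Hf.
have [P PE] := trig_exists m f l1.
exists P; first by exists m, l, f.
pose M := \max_(j < m) N j.
rewrite Sbar_cls (Vbar_cls cA cB sB) -!clsB.
apply: (@rnorm_cls_le _ _ _ _ M) => [|n Mn]; first exact: ltW.
rewrite !linfBE (VopE cA cB sB) -[seqshift _ n]/(P n.+1) PE.
rewrite restrE vE.
have cE : conv B (restr P) n =
    \sum_(j < m) conv B (fun n => l j ^+ n *: f j) n.
  rewrite /Defs.conv exchange_big /=; apply: eq_bigr => k _.
  by rewrite PE linear_sum.
rewrite cE restrE PE linear_sum -big_split -!sumrB /=.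
rewrite (le_trans (rnorm_sum_le (a := e / m.+1%:R) (u := fun j =>
  l j ^+ n.+1 *: f j - (A (l j ^+ n *: f j) +
  conv B (fun n => l j ^+ n *: f j) n) - l j ^+ n *: y j) _))//.
  move=> j jm; have := HN j n; rewrite /resop scalerA -exprS opprD addrA.
  apply; apply: leq_trans Mn.
  exact: (@leq_bigmax _ (fun j : 'I_m => N j) (Ordinal jm)).
rewrite mulrCA ger_pMr// ler_pdivrMr ?ltr0n// mul1r.
by rewrite ler_nat.
Qed.

Lemma solution_cls (x y : linf) :
  (forall n, x n.+1 = A (x n) + \sum_(k < n.+1) B (n - k)%N (x k) + y n) ->
  Sbar (cls x) - Vb (cls x) = cls y.
Proof.
move=> xE; rewrite Sbar_cls (Vbar_cls cA cB sB) -clsB; congr cls.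
apply: linfP => n; rewrite linfBE (VopE cA cB sB) -[seqshift x n]/(x n.+1) xE.
rewrite (_ : \sum_(k < n.+1) _ = conv B x n) ?[_ + y n]addrC ?addrK//.
rewrite /Defs.conv (reindex_inj rev_ord_inj) /=; apply: eq_bigr => k _.
by rewrite subSS subKn// -ltnS.
Qed.

Lemma null_solution (x y : linf) : y \in c0_pred ->
  (forall n, x n.+1 = A (x n) + \sum_(k < n.+1) B (n - k)%N (x k) + y n) ->
  x n @[n --> \oo] --> (0 : X).
Proof.
move=> y0 /solution_cls xE; apply/c0_predP/cls_eq0P/rnorm0_eq0/eqP.
have [C C0 HC] := Sbar_sub_Vbar_bounded_below cA cB sB hcount hres.
rewrite eq_le rnorm_ge0 andbT (le_trans (HC _))// xE.
rewrite (_ : cls y = 0) ?rnorm0 ?mulr0// -cls0; apply/clsP.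
by rewrite subr0.
Qed.

Lemma AAP_solution (x y : linf) : AAP_nat y ->
  (forall n, x n.+1 = A (x n) + \sum_(k < n.+1) B (n - k)%N (x k) + y n) ->
  AAP_nat x.
Proof.
move=> [u [w [u0 [v vAP wv] yE]]] /solution_cls xE.
have [C C0 HC] := Sbar_sub_Vbar_bounded_below cA cB sB hcount hres.
have yw : cls y = cls (restr v).
  apply/clsP; rewrite yE (_ : w = restr v) ?addrK//.
  by apply: linfP => n; rewrite wv.
have approx (e : R) : 0 < e -> exists2 P : Defs.linf int X, trig P &
    rnorm (cls x - cls (restr P)) <= e.
  move=> e0; pose d := e / (2 * (C + 1)).
  have d0 : 0 < d by rewrite divr_gt0// mulr_gt0// ltr_wpDl.
  have [v' [/span_trig tv' vv']] : exists v',
      linear_span ap_exponentials v' /\ rnorm (v - v') <= d.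
    have [|v' [sv' bv']] := vAP (ball v d%:C).
      by apply: nbhsx_ballx; rewrite ltcR.
    exists v'; split=> //; move: bv'; rewrite -ball_normE /= rnormE ltcR.
    exact: ltW.
  have [P tP HP] := trig_approx tv' d0.
  exists P => //; rewrite (le_trans (HC _))//.
  pose T : {linear quo -> quo} := HB.pack_for {linear quo -> quo} Vb
    (GRing.isLinear.Build _ _ _ _ _ (Vbar_linear cA cB sB)).
  pose S : {linear quo -> quo} := HB.pack_for {linear quo -> quo}
    (@Sbar R X) (GRing.isLinear.Build _ _ _ _ _ (@Sbar_is_linear R X)).
  set q := cls (restr P) in HP *.
  have -> : Sbar (cls x - q) - Vb (cls x - q) = cls y - (Sbar q - Vb q).
    rewrite -[LHS]/(S (cls x - q) - T (cls x - q)) (linearB S) (linearB T).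
    by rewrite -xE !opprD !opprK addrACA.
  apply: (@le_trans _ _ (C * (2 * d))).
    rewrite ler_wpM2l// (le_trans (rdistD (cls (restr v')) _ _))//.
    rewrite mulr_natl mulr2n lerD//; last by rewrite rdistC.
    by rewrite yw -clsB -restrB (le_trans (rnorm_cls_restr _)).
  have -> : C * (2 * d) = e * (C / (C + 1)).
    by rewrite /d; field; rewrite gt_eqF// ltr_wpDl.
  by rewrite ger_pMr// ler_pdivrMr ?ltr_wpDl// mul1r lerDl.
have /choice[P HP] k : exists P : Defs.linf int X, trig P /\
    rnorm (cls x - cls (restr P)) <= 1 / 2 ^+ k.
  have [|P tP PE] := approx (1 / 2 ^+ k); last by exists P.
  by rewrite divr_gt0 ?exprn_gt0.
(* The sup-norm distance of two approximations is controlled on the quotient,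
   so they converge uniformly on the integers. *)
have [|s Hs] := linf_geo_complete (I := int) (@complete_geo_complete R X)
    (c := 2) (u := fun k => P k.+1 - P k).
  move=> k; rewrite (le_trans (rnorm_trig _))//.
    by apply: trigB; [have [] := HP k.+1 | have [] := HP k].
  rewrite restrB clsB (le_trans (rdistD (cls x) _ _))//.
  have -> : 2 / 2 ^+ k = 1 / 2 ^+ k + 1 / 2 ^+ k :> R by rewrite -mulrDl.
  rewrite lerD//; last by have [] := HP k.
  rewrite rdistC (le_trans (proj2 (HP k.+1)))// !div1r.
  rewrite lef_pV2 ?posrE ?exprn_gt0// exprS ler_peMl ?exprn_ge0//.
  by rewrite ler1n.
pose W := s + P 0%N.
have HW n : rnorm (W - P n) <= 2 * 2 / 2 ^+ n.
  have := Hs n; rewrite -(big_mkord xpredT (fun k => P k.+1 - P k)).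
  by rewrite telescope_sumr// opprB addrA.
have WAP : AP_int W.
  move=> D /nbhs_ballP[r r0 rD]; have r0' : 0 < complex.Re r.
    by rewrite -ltcR ReK_ge0// ltW.
  have [||n Hn] := @geo_small R (2 * 2) (complex.Re r / 2) => //.
    by rewrite divr_gt0.
  exists (P n); split; first by apply: trig_span; have [] := HP n.
  apply: rD; rewrite -ball_normE /= rnormE -(ReK_ge0 (ltW r0)) ltcR.
  rewrite (le_lt_trans (HW n))// (le_lt_trans (Hn n _))//.
  by rewrite ltr_pdivrMr// ltr_pMr// ltr1n.
have xW : cls x = cls (restr W).
  apply/eqP; rewrite -subr_eq0; apply/eqP/rnorm_le0 => e e0.
  have [||n Hn] := @geo_small R (1 + 2 * 2) e => //.
  rewrite (le_trans _ (Hn n (leqnn _)))// mulrDl.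
  rewrite (le_trans (rdistD (cls (restr (P n))) _ _))// lerD//.
    by have [] := HP n.
  by rewrite rdistC -clsB -restrB (le_trans (rnorm_cls_restr _)) ?HW.
have xW0 : x - restr W \in c0_pred by apply/clsP.
exists (x - restr W), (restr W); split=> //; last by rewrite subrK.
by exists W.
Qed.

(** If [||A|| + \sum_n ||B n|| <= 1], a solution never exceeds its initial
    value. *)
Lemma contractive_bounded (x : nat -> X) :
  ((opnorm A)%:E + \sum_(0 <= n <oo) (opnorm (B n))%:E <= 1)%E ->
  (forall n, x n.+1 = A (x n) + \sum_(k < n.+1) B (n - k)%N (x k)) ->
  forall n, rnorm (x n) <= rnorm (x 0%N).
Proof.
move=> AB1 xE n.
have AB n' : opnorm A + \sum_(k < n') opnorm (B k) <= 1.
  rewrite -lee_fin EFinD (le_trans _ AB1)// leeD2l//.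
  rewrite -(big_mkord xpredT (fun k => opnorm (B k))) -sumEFin.
  by apply: nneseries_lim_ge => k _ _; rewrite lee_fin opnorm_ge0.
suff : forall k, (k <= n)%N -> rnorm (x k) <= rnorm (x 0%N) by exact.
elim: n => [k|n IH k]; first by rewrite leqn0 => /eqP ->.
rewrite leq_eqVlt ltnS => /orP[/eqP ->|/IH//].
rewrite xE (le_trans (rnormD _ _))//.
rewrite (@le_trans _ _ ((opnorm A + \sum_(k < n.+1) opnorm (B k)) * rnorm (x 0%N)))//.
  rewrite mulrDl lerD//.
    by rewrite (le_trans (le_opnorm _ cA))// ler_wpM2l ?opnorm_ge0// IH.
  rewrite (le_trans (rnorm_sum n.+1 (fun k => B (n - k)%N (x k))))//.
  rewrite mulr_suml [leRHS](reindex_inj rev_ord_inj)/=; apply: ler_sum => i _.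
  rewrite subSS (le_trans (le_opnorm _ (@cB _)))// ler_wpM2l ?opnorm_ge0//.
  by rewrite IH// -ltnS.
by rewrite ler_piMl ?rnorm_ge0.
Qed.

End Solutions.

Theorem theorem4p11 (R : realType) (X : completeNormedModType R[i])
    (A : {linear X -> X}) (B : nat -> {linear X -> X})
    (cA : continuous A) (cB : forall k, continuous (B k))
    (sB : (\sum_(0 <= k <oo) (opnorm (B k))%:E < +oo)%E)
    (hcount : countable (spectrum (Vbar A B) `&` unit_circle R))
    (hres : residual_spectrum (Vbar A B) `&` unit_circle R = set0) :
  [/\ ((opnorm A)%:E + \sum_(0 <= n <oo) (opnorm (B n))%:E <= 1)%E ->
      forall x : nat -> X,
        (forall n, x n.+1 = A (x n) + \sum_(k < n.+1) B (n - k)%N (x k)) ->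
        x n @[n --> \oo] --> (0 : X),
      forall y : linf nat X, y \in c0_pred ->
      forall x : linf nat X,
        (forall n, x n.+1 = A (x n) + \sum_(k < n.+1) B (n - k)%N (x k) + y n) ->
        x n @[n --> \oo] --> (0 : X)
    & forall y : linf nat X, AAP_nat y ->
      forall x : linf nat X,
        (forall n, x n.+1 = A (x n) + \sum_(k < n.+1) B (n - k)%N (x k) + y n) ->
        AAP_nat x].
Proof.
split=> [AB1 x xE|y y0 x|y yAAP x].
- have [z zx] := linf_of_bound (contractive_bounded cA cB AB1 xE).
  rewrite (_ : (fun n => x n) = z); last by apply/funext => n; rewrite zx.
  apply: (null_solution cA cB sB hcount hres (rpred0 c0_pred)) => n.
  by rewrite addr0 !zx xE; congr (_ + _); apply: eq_bigr => k _; rewrite zx.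
- exact: null_solution.
- exact: AAP_solution.
Qed.
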